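(* Let $X$ be a compact Hausdorff space and let $\alpha$, $\beta$ be oriented $3$-dimensional real vector bundles over $X$ with positive-definite inner products. Then the bundles of quaternion algebras $\mathbb{H}_\alpha$ and $\mathbb{H}_\beta$ are Morita equivalent if and only if $w_2(\alpha)=w_2(\beta)$ in $H^2(X;\mathbb{Z}/2)$.
   Context: For an oriented $3$-dimensional real vector bundle $\alpha$ over $X$ with positive-definite inner product, $\mathbb{H}_\alpha$ is the bundle of quaternion algebras $\mathbb{R}1\oplus\alpha$ with multiplication $(s,u)\cdot(t,v)=(st-\langle u,v\rangle,\ sv+tu+u\times v)$, where $\times$ is the vector product determined by the inner product and orientation. $A^{\mathrm{o}}$ denotes the opposite algebra. Two bundles $\mathbb{H}_\alpha$ and $\mathbb{H}_\beta$ are called Morita equivalent if there are a $4$-dimensional real vector bundle $\mu$ over $X$ and an isomorphism of bundles of real algebras $\mathbb{H}_\alpha\otimes_{\mathbb{R}}\mathbb{H}_\beta^{\mathrm{o}}\cong\operatorname{End}_{\mathbb{R}}(\mu)$. $w_2$ is the second Stiefel-Whitney class. *)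

(* Defs.v *)
From HB Require Import structures.
From mathcomp Require Import all_boot all_order all_algebra.
From mathcomp Require Import all_classical all_reals all_analysis.

Set Implicit Arguments.
Unset Strict Implicit.
Unset Printing Implicit Defensive.

Import Order.TTheory GRing.Theory Num.Theory.
Import numFieldNormedType.Exports.

Local Open Scope classical_set_scope.
Local Open Scope ring_scope.

(* An abstract finite-dimensional real vector space carries no canonical      *)
(* topology instance; continuity of a map into it is continuity of all its    *)
(* composites with linear functionals, and a family of linear maps between    *)
(* two fixed spaces is continuous when all its values are.                    *)
Section Continuity.
Context {R : realType} {X : topologicalType}.

Definition vcont (W : vectType R) (x : X) (f : X -> W) :=
  forall l : 'Hom(W, R^o), continuous_at x (fun y => l (f y) : R).

Definition hcont (V W : vectType R) (x : X) (T : X -> 'Hom(V, W)) :=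
  forall v : V, vcont x (fun y => T y v).

Lemma vcont_cst (W : vectType R) x (w : W) : vcont x (fun=> w).
Proof. by move=> l; apply: cvg_cst. Qed.

Lemma vcontD (W : vectType R) x (f g : X -> W) :
  vcont x f -> vcont x g -> vcont x (fun y => f y + g y).
Proof.
move=> cf cg l; under eq_fun do rewrite linearD.
exact: (cvgD (cf l) (cg l)).
Qed.

Lemma vcontZ (W : vectType R) x (a : X -> R) (f : X -> W) :
  continuous_at x a -> vcont x f -> vcont x (fun y => a y *: f y).
Proof.
move=> ca cf l; under eq_fun do rewrite linearZ.
exact: (cvgM ca (cf l)).
Qed.

Lemma vcont_sum (W : vectType R) x (I : Type) (r : seq I) (f : I -> X -> W) :
  (forall i, vcont x (f i)) -> vcont x (fun y => \sum_(i <- r) f i y).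
Proof.
move=> cf; elim: r => [|i r IHr].
  by under eq_fun do rewrite big_nil; apply: vcont_cst.
by under eq_fun do rewrite big_cons; apply: vcontD.
Qed.

Lemma vcont_coord (W : vectType R) x (f : X -> W) k :
  vcont x f ->
  continuous_at x (fun y => coord (vbasis {:W}) k (f y) : R).
Proof.
move=> cf; have := cf (linfun (coord (vbasis {:W}) k : W -> R^o)).
by under eq_fun do rewrite lfunE.
Qed.

Lemma vcont_lfun (V W : vectType R) x (T : X -> 'Hom(V, W)) (f : X -> V) :
  hcont x T -> vcont x f -> vcont x (fun y => T y (f y)).
Proof.
move=> cT cf.
have -> : (fun y => T y (f y)) = fun y => \sum_(i < \dim {:V})
    coord (vbasis {:V}) i (f y) *: T y (vbasis {:V})`_i.
  apply/funext => y; rewrite {1}(coord_vbasis (memvf (f y))) linear_sum.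
  by apply: eq_bigr => i _; rewrite linearZ.
by apply: vcont_sum => i; apply: vcontZ; [apply: vcont_coord | apply: cT].
Qed.

Lemma hcont_comp (U V W : vectType R) x
    (S : X -> 'Hom(V, W)) (T : X -> 'Hom(U, V)) :
  hcont x S -> hcont x T -> hcont x (fun y => (S y \o T y)%VF).
Proof.
move=> cS cT u; under eq_fun do rewrite comp_lfunE.
exact: vcont_lfun.
Qed.

Lemma hcont_vcont (V W : vectType R) x (T : X -> 'Hom(V, W)) :
  hcont x T -> vcont x T.
Proof.
move=> cT.
pose E k v : 'Hom(V, W) := linfun (fun u : V => coord (vbasis {:V}) k u *: v).
have EE k v u : E k v u = coord (vbasis {:V}) k u *: v.
  have lE : linear (fun u : V => coord (vbasis {:V}) k u *: v).
    by move=> a u1 u2; rewrite linearP /= scalerDl scalerA.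
  pose L := GRing.isLinear.Build _ _ _ _ _ lE.
  pose F : {linear V -> W} := HB.pack (fun u : V => _) L.
  exact: (lfunE F).
have -> : T = fun y => \sum_(i < \dim {:V}) \sum_(j < \dim {:W})
    coord (vbasis {:W}) j (T y (vbasis {:V})`_i) *: E i (vbasis {:W})`_j.
  apply/funext => y; apply/lfunP => u.
  rewrite {1}(coord_vbasis (memvf u)) linear_sum sum_lfunE.
  apply: eq_bigr => i _; rewrite linearZ sum_lfunE.
  rewrite [X in _ *: X = _](coord_vbasis (memvf _)) scaler_sumr.
  apply: eq_bigr => j _; rewrite scale_lfunE EE !scalerA; congr (_ *: _).
  exact: mulrC.
apply: vcont_sum => i; apply: vcont_sum => j; apply: vcontZ.
  exact: vcont_coord.
exact: vcont_cst.
Qed.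

End Continuity.

(* Tensor product of finite-dimensional spaces, in coordinates: the entry     *)
(* (i, j) is the coefficient of e_i (x) f_j, for the bases vbasis of V and W. *)
Section Tensor.
Context {R : realType}.

Definition tensor (V W : vectType R) : vectType R :=
  'M[R]_(\dim {:V}, \dim {:W}).

Definition tens (V W : vectType R) (v : V) (w : W) : tensor V W :=
  \matrix_(i, j) (coord (vbasis {:V}) i v * coord (vbasis {:W}) j w).

(* The linear map on V (x) W induced by a bilinear map B (see tliftE).        *)
Definition tlift (V W Z : vectType R) (B : V -> W -> Z) (M : tensor V W) : Z :=
  \sum_i \sum_j M i j *: B (vbasis {:V})`_i (vbasis {:W})`_j.

Definition bilin (V W Z : vectType R) (B : V -> W -> Z) :=
  (forall w, linear (B^~ w)) /\ (forall v, linear (B v)).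

Lemma tlift_linear (V W Z : vectType R) (B : V -> W -> Z) : linear (tlift B).
Proof.
move=> a M N; rewrite /tlift scaler_sumr -big_split; apply: eq_bigr => i _ /=.
rewrite scaler_sumr -big_split; apply: eq_bigr => j _ /=.
by rewrite !mxE scalerDl scalerA.
Qed.

Lemma linear_sumE (V Z : vectType R) (f : V -> Z) (I : Type) (r : seq I)
    (a : I -> R) (v : I -> V) :
  linear f -> f (\sum_(i <- r) a i *: v i) = \sum_(i <- r) a i *: f (v i).
Proof.
move=> lf; have f0 : f 0 = 0.
  by have := lf (-1) 0 0; rewrite scaler0 addr0 scaleN1r addNr.
by elim: r => [|i r IHr]; rewrite ?big_nil // !big_cons lf IHr.
Qed.

Lemma tliftE (V W Z : vectType R) (B : V -> W -> Z) v w :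
  bilin B -> tlift B (tens v w) = B v w.
Proof.
move=> [Bl Br]; rewrite {2}(coord_vbasis (memvf v)).
rewrite (linear_sumE _ _ _ (Bl w)); apply: eq_bigr => i _.
rewrite {2}(coord_vbasis (memvf w)) (linear_sumE _ _ _ (Br _)) scaler_sumr.
by apply: eq_bigr => j _; rewrite mxE scalerA.
Qed.

Lemma bilin_tens (V W : vectType R) : bilin (@tens V W).
Proof.
split=> [w a u v|v a u w]; apply/matrixP => i j; rewrite !mxE linearP /=.
  by rewrite mulrDl mulrA.
by rewrite mulrDr mulrCA.
Qed.

Lemma tensE (V W : vectType R) (M : tensor V W) : M = tlift (@tens V W) M.
Proof.
apply/matrixP => i j; rewrite /tlift summxE.
have fV : free (vbasis {:V}) := basis_free (vbasisP _).
have fW : free (vbasis {:W}) := basis_free (vbasisP _).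
transitivity (\sum_(k < \dim {:V}) \sum_(l < \dim {:W})
    M k l * ((i == k)%:R * (j == l)%:R)).
  rewrite (bigD1 i) //= [X in _ + X]big1 => [|k ki].
    rewrite addr0 (bigD1 j) //= big1 => [|l lj].
      by rewrite !eqxx !mulr1 addr0.
    by rewrite (eq_sym j) (negPf lj) !mulr0.
  by rewrite big1 // => l _; rewrite eq_sym (negPf ki) mul0r mulr0.
apply: eq_bigr => k _; rewrite summxE; apply: eq_bigr => l _.
rewrite !mxE (coord_free _ _ fV) (coord_free _ _ fW).
by rewrite (eq_sym i) (eq_sym j).
Qed.

Lemma tensor_ext (V W Z : vectType R) (f g : tensor V W -> Z) :
  linear f -> linear g -> (forall v w, f (tens v w) = g (tens v w)) -> f =1 g.
Proof.
move=> lf lg fg M; rewrite (tensE M) /tlift pair_big /=.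
by rewrite !linear_sumE //; apply: eq_bigr => i _; rewrite fg.
Qed.

Definition tmap (V V' W W' : vectType R) (f : 'Hom(V, V')) (g : 'Hom(W, W')) :
    'Hom(tensor V W, tensor V' W') :=
  linfun (tlift (fun v w => tens (f v) (g w))).

Lemma tmapE (V V' W W' : vectType R) (f : 'Hom(V, V')) (g : 'Hom(W, W')) M :
  tmap f g M = tlift (fun v w => tens (f v) (g w)) M.
Proof.
pose L := GRing.isLinear.Build _ _ _ _ _
  (tlift_linear (fun v w => tens (f v) (g w))).
pose F : {linear tensor V W -> tensor V' W'} := HB.pack (tlift _) L.
exact: (lfunE F).
Qed.

Lemma tmap_tens (V V' W W' : vectType R) (f : 'Hom(V, V')) (g : 'Hom(W, W'))
    v w : tmap f g (tens v w) = tens (f v) (g w).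
Proof.
have [tl tr] := @bilin_tens V' W'.
by rewrite tmapE tliftE //; split=> [w1|v1] a u1 u2; rewrite linearP ?tl ?tr.
Qed.

Lemma tmap_comp (V V' V'' W W' W'' : vectType R)
    (f' : 'Hom(V', V'')) (g' : 'Hom(W', W''))
    (f : 'Hom(V, V')) (g : 'Hom(W, W')) :
  (tmap f' g' \o tmap f g = tmap (f' \o f) (g' \o g))%VF.
Proof.
apply/lfunP; apply: tensor_ext; try exact: linearP.
by move=> v w; rewrite comp_lfunE !tmap_tens !comp_lfunE.
Qed.

Lemma tmap_id (V W : vectType R) (f : 'End(V)) (g : 'End(W)) :
  f =1 id -> g =1 id -> tmap f g =1 id.
Proof.
move=> f1 g1; apply: tensor_ext; [exact: linearP | by [] |].
by move=> v w; rewrite tmap_tens f1 g1.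
Qed.

(* (a (x) b) (a' (x) b') = a a' (x) b b', extended bilinearly.                *)
Definition tensor_mul (V W : vectType R) (mV : V -> V -> V) (mW : W -> W -> W)
    (M N : tensor V W) : tensor V W :=
  tlift (fun a b => tlift (fun a' b' => tens (mV a a') (mW b b')) N) M.

Lemma tensor_mul_tens (V W : vectType R) (mV : V -> V -> V) (mW : W -> W -> W)
    a b a' b' : bilin mV -> bilin mW ->
  tensor_mul mV mW (tens a b) (tens a' b') = tens (mV a a') (mW b b').
Proof.
move=> [Vl Vr] [Wl Wr]; have [tl tr] := @bilin_tens V W.
have bi c d : bilin (fun a' b' => tens (mV c a') (mW d b')).
  by split=> [w|v] s u1 u2; rewrite ?Vr ?Wr ?tl ?tr.
rewrite /tensor_mul tliftE ?tliftE //.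
by split=> [w|v] s u1 u2; rewrite !tliftE // ?Vl ?Wl ?tl ?tr.
Qed.

End Tensor.

(* A real vector bundle over X with fibres isomorphic to F, given by its      *)
(* fibres and an atlas of local trivialisations; frame i x is the inverse of  *)
(* triv i x.  Values of triv and frame outside dom i are irrelevant.          *)
Record vbundle (R : realType) (X : topologicalType) (F : vectType R) :=
  VBundle {
    fib : X -> vectType R;
    idx : Type;
    dom : idx -> set X;
    triv : idx -> forall x, 'Hom(fib x, F);
    frame : idx -> forall x, 'Hom(F, fib x);
    dom_open : forall i, open (dom i);
    dom_cover : forall x, exists i, dom i x;
    trivK : forall i x, dom i x -> cancel (triv i x) (frame i x);
    frameK : forall i x, dom i x -> cancel (frame i x) (triv i x);
    trans_cont : forall i j x, dom i x -> dom j x ->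
      hcont x (fun y => (triv j y \o frame i y)%VF)
  }.
Arguments fib {R X F} _ _.
Arguments idx {R X F} _.
Arguments dom {R X F} _ _ _.
Arguments triv {R X F} _ _ _.
Arguments frame {R X F} _ _ _.

(* A morphism of vector bundles over the identity of X. *)
Definition bundle_map_cont (R : realType) (X : topologicalType)
    (F F' : vectType R) (E : vbundle X F) (E' : vbundle X F')
    (Psi : forall x, 'Hom(fib E x, fib E' x)) :=
  forall i j x, dom E i x -> dom E' j x ->
    hcont x (fun y => (triv E' j y \o (Psi y \o frame E i y))%VF).

(* A vector bundle with a multiplication and a unit in each fibre.  The       *)
(* algebra laws are not recorded: only the concrete bundles below are used.   *)
Record algbundle (R : realType) (X : topologicalType) (F : vectType R) :=
  AlgBundle {
    vb :> vbundle X F;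
    amul : forall x, fib vb x -> fib vb x -> fib vb x;
    aone : forall x, fib vb x
  }.
Arguments amul {R X F} _ _ _ _.
Arguments aone {R X F} _ _.

(* The inverse of a continuous fibrewise bijective map of finite-dimensional  *)
(* vector bundles is automatically continuous.                                *)
Definition alg_iso (R : realType) (X : topologicalType) (F F' : vectType R)
    (A : algbundle X F) (B : algbundle X F') :=
  exists Psi : forall x, 'Hom(fib A x, fib B x),
    [/\ bundle_map_cont Psi,
        forall x, bijective (Psi x),
        forall x, Psi x (aone A x) = aone B x &
        forall x a b, Psi x (amul A x a b) = amul B x (Psi x a) (Psi x b)].

Definition opp_alg (R : realType) (X : topologicalType) (F : vectType R)
    (A : algbundle X F) : algbundle X F :=
  @AlgBundle R X F A (fun x a b => amul A x b a) (aone A).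

Section TensorBundle.
Context {R : realType} {X : topologicalType} {F G : vectType R}.
Variables (E : vbundle X F) (E' : vbundle X G).

Let tdom (k : idx E * idx E') := dom E k.1 `&` dom E' k.2.
Let ttriv (k : idx E * idx E') x := tmap (triv E k.1 x) (triv E' k.2 x).
Let tframe (k : idx E * idx E') x := tmap (frame E k.1 x) (frame E' k.2 x).

Let tdom_open k : open (tdom k).
Proof. by apply: openI; apply: dom_open. Qed.

Let tdom_cover x : exists k, tdom k x.
Proof.
by have [i ?] := dom_cover E x; have [j ?] := dom_cover E' x; exists (i, j).
Qed.

Let ttrivK k x : tdom k x -> cancel (ttriv k x) (tframe k x).
Proof.
move=> [d1 d2] M; rewrite -comp_lfunE tmap_comp.
by apply: tmap_id => v; rewrite comp_lfunE trivK.
Qed.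

Let tframeK k x : tdom k x -> cancel (tframe k x) (ttriv k x).
Proof.
move=> [d1 d2] M; rewrite -comp_lfunE tmap_comp.
by apply: tmap_id => v; rewrite comp_lfunE frameK.
Qed.

Let ttrans_cont k l x : tdom k x -> tdom l x ->
  hcont x (fun y => (ttriv l y \o tframe k y)%VF).
Proof.
move=> [k1 k2] [l1 l2] M; under eq_fun do rewrite tmap_comp tmapE.
have tens_cont u w : vcont x u -> vcont x w ->
    vcont x (fun y => @tens R F G (u y) (w y)).
  move=> cu cw.
  have -> : (fun y => tens (u y) (w y)) =
      fun y => \sum_i \sum_j (coord (vbasis {:F}) i (u y) *
        coord (vbasis {:G}) j (w y)) *:
        tens (vbasis {:F})`_i (vbasis {:G})`_j.
    apply/funext => y; rewrite {1}(tensE (tens (u y) (w y))).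
    by apply: eq_bigr => i _; apply: eq_bigr => j _; rewrite mxE.
  apply: vcont_sum => i; apply: vcont_sum => j; apply: vcontZ.
    by apply: cvgM; apply: vcont_coord.
  exact: vcont_cst.
apply: vcont_sum => i; apply: vcont_sum => j; apply: vcontZ.
  exact: cvg_cst.
by apply: tens_cont; apply: trans_cont.
Qed.

Definition tensor_bundle : vbundle X (tensor F G) :=
  @VBundle R X (tensor F G) (fun x => tensor (fib E x) (fib E' x))
    (idx E * idx E')%type tdom ttriv tframe
    tdom_open tdom_cover ttrivK tframeK ttrans_cont.

End TensorBundle.

Definition tensor_alg (R : realType) (X : topologicalType) (F G : vectType R)
    (A : algbundle X F) (B : algbundle X G) : algbundle X (tensor F G) :=
  @AlgBundle R X (tensor F G) (tensor_bundle A B)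
    (fun x => tensor_mul (amul A x) (amul B x))
    (fun x => tens (aone A x) (aone B x)).

Section EndBundle.
Context {R : realType} {X : topologicalType} {F : vectType R}.
Variable M : vbundle X F.

Definition lconj (V W : vectType R) (f : 'Hom(V, W)) (g : 'Hom(W, V)) :
    'Hom('End(V), 'End(W)) :=
  linfun (fun h : 'End(V) => (f \o (h \o g))%VF).

Lemma lconjE (V W : vectType R) (f : 'Hom(V, W)) (g : 'Hom(W, V)) h :
  lconj f g h = (f \o (h \o g))%VF.
Proof.
have lc : linear (fun h : 'End(V) => (f \o (h \o g))%VF).
  move=> a h1 h2; apply/lfunP => w.
  by rewrite !(comp_lfunE, add_lfunE, scale_lfunE) linearP.
pose L := GRing.isLinear.Build _ _ _ _ _ lc.
pose C : {linear 'End(V) -> 'End(W)} := HB.pack (fun h : 'End(V) => _) L.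
exact: (lfunE C).
Qed.

Let etriv (i : idx M) x := lconj (triv M i x) (frame M i x).
Let eframe (i : idx M) x := lconj (frame M i x) (triv M i x).

Let etrivK i x : dom M i x -> cancel (etriv i x) (eframe i x).
Proof.
move=> di h; rewrite !lconjE; apply/lfunP => v.
by rewrite !comp_lfunE !trivK.
Qed.

Let eframeK i x : dom M i x -> cancel (eframe i x) (etriv i x).
Proof.
move=> di h; rewrite !lconjE; apply/lfunP => v.
by rewrite !comp_lfunE !frameK.
Qed.

Let etrans_cont i j x : dom M i x -> dom M j x ->
  hcont x (fun y => (etriv j y \o eframe i y)%VF).
Proof.
move=> di dj h; apply: hcont_vcont.
have -> : (fun y => (etriv j y \o eframe i y)%VF h) =
    fun y => ((triv M j y \o frame M i y) \o
              (h \o (triv M i y \o frame M j y)))%VF.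
  by apply/funext => y; rewrite comp_lfunE !lconjE !comp_lfunA.
apply: hcont_comp; first exact: trans_cont.
apply: hcont_comp; last exact: trans_cont.
by move=> v; apply: vcont_cst.
Qed.

Definition end_alg : algbundle X 'End(F) :=
  @AlgBundle R X 'End(F)
    (@VBundle R X 'End(F) (fun x => 'End(fib M x) : vectType R) (idx M) (dom M)
       etriv eframe (@dom_open _ _ _ M) (dom_cover M)
       etrivK eframeK etrans_cont)
    (fun x f g => (f \o g)%VF) (fun x => \1%VF).

End EndBundle.

(* An oriented Euclidean bundle of rank 3.  pos x is the set of positively    *)
(* oriented bases of the fibre at x.                                          *)
Record oe3bundle (R : realType) (X : topologicalType) := OE3Bundle {
  ob :> vbundle X 'rV[R]_3;
  ip : forall x, fib ob x -> fib ob x -> R;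
  ip_lin : forall x a (u v w : fib ob x),
    ip (a *: u + v) w = a * ip u w + ip v w;
  ip_sym : forall x (u v : fib ob x), ip u v = ip v u;
  ip_pos : forall x (u : fib ob x), u != 0 -> 0 < ip u u;
  ip_cont : forall i x (a b : 'rV[R]_3), dom ob i x ->
    continuous_at x (fun y => ip (frame ob i y a) (frame ob i y b));
  pos : forall x, set (3.-tuple (fib ob x));
  pos_basis : forall x e, @pos x e -> basis_of {:fib ob x} e;
  pos_ex : forall x, exists e, @pos x e;
  pos_det : forall x (e f : 3.-tuple (fib ob x)),
    @pos x e -> basis_of {:fib ob x} f ->
    (@pos x f <-> 0 < \det (\matrix_(k, l) coord e l (tnth f k)));
  pos_cont : forall i x, dom ob i x -> \forall y \near x,
    (@pos y [tuple frame ob i y (delta_mx 0 k) | k < 3] <->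
     @pos x [tuple frame ob i x (delta_mx 0 k) | k < 3])
}.
Arguments ip {R X} _ {x} _ _.
Arguments pos {R X} _ _ _.

(* Multiplication on R1 (+) V for an inner product and a vector product.      *)
Definition qmul (R : realType) (V : vectType R) (dot : V -> V -> R)
    (cr : V -> V -> V) (p q : R^o * V) : R^o * V :=
  (p.1 * q.1 - dot p.2 q.2, p.1 *: q.2 + q.1 *: p.2 + cr p.2 q.2).

Section QuaternionBundle.
Context {R : realType} {X : topologicalType}.
Variable A : oe3bundle R X.

(* The signed volume of (u, v, w): up to sign, the square root of the Gram    *)
(* determinant, which vanishes when the vectors are linearly dependent.       *)
Definition vol x (u v w : fib A x) : R :=
  let e := [tuple u; v; w] in
  (if `[< pos A x e >] then 1 else -1) *
  Num.sqrt (\det (\matrix_(k, l) ip A (tnth e k) (tnth e l))).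

(* u x v is the vector representing the functional vol u v. *)
Definition cross x (u v : fib A x) : fib A x :=
  xget 0 [set w | forall z, ip A w z = vol u v z].

Definition rid_lfun (V W : vectType R) (f : 'Hom(V, W)) :
    'Hom((R^o * V)%type, (R^o * W)%type) :=
  linfun (fun p : R^o * V => (p.1, f p.2)).

Lemma rid_lfunE (V W : vectType R) (f : 'Hom(V, W)) p :
  rid_lfun f p = (p.1, f p.2).
Proof.
have lr : linear (fun p : R^o * V => (p.1, f p.2)).
  by move=> a p1 p2; rewrite /= linearP.
pose L := GRing.isLinear.Build _ _ _ _ _ lr.
pose C : {linear (R^o * V)%type -> (R^o * W)%type} :=
  HB.pack (fun p : R^o * V => _) L.
exact: (lfunE C).
Qed.

Let htriv (i : idx A) x := rid_lfun (triv A i x).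
Let hframe (i : idx A) x := rid_lfun (frame A i x).

Let htrivK i x : dom A i x -> cancel (htriv i x) (hframe i x).
Proof. by move=> di [s v]; rewrite !rid_lfunE /= trivK. Qed.

Let hframeK i x : dom A i x -> cancel (hframe i x) (htriv i x).
Proof. by move=> di [s v]; rewrite !rid_lfunE /= frameK. Qed.

Let htrans_cont i j x : dom A i x -> dom A j x ->
  hcont x (fun y => (htriv j y \o hframe i y)%VF).
Proof.
move=> di dj [s v] l.
pose inr_lin (w : 'rV[R]_3) : R^o * 'rV[R]_3 := (0, w).
have li : linear inr_lin.
  by move=> a u w; rewrite /inr_lin; congr pair => /=; rewrite scaler0 addr0.
pose L := GRing.isLinear.Build _ _ _ _ _ li.
pose C : {linear 'rV[R]_3 -> (R^o * 'rV[R]_3)%type} := HB.pack inr_lin L.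
have -> : (fun y => l ((htriv j y \o hframe i y)%VF (s, v))) =
    fun y => (l \o linfun C)%VF ((triv A j y \o frame A i y)%VF v) + l (s, 0).
  apply/funext => y; rewrite !comp_lfunE !rid_lfunE lfunE /= -linearD.
  by congr (l _); rewrite /inr_lin; congr pair => /=; rewrite ?add0r ?addr0.
apply: cvgD; last exact: cvg_cst.
exact: (trans_cont di dj).
Qed.

Definition quat_alg : algbundle X (R^o * 'rV[R]_3)%type :=
  @AlgBundle R X (R^o * 'rV[R]_3)%type
    (@VBundle R X (R^o * 'rV[R]_3)%type
       (fun x => (R^o * fib A x)%type : vectType R) (idx A) (dom A)
       htriv hframe (@dom_open _ _ _ A) (dom_cover A)
       htrivK hframeK htrans_cont)
    (fun x => qmul (@ip R X A x) (@cross x)) (fun x => (1, 0)).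

End QuaternionBundle.

Definition morita (R : realType) (X : topologicalType) (A B : oe3bundle R X) :=
  exists M : vbundle X 'rV[R]_4,
    alg_iso (tensor_alg (quat_alg A) (opp_alg (quat_alg B))) (end_alg M).

(* Cech cohomology H^2(X; Z/2): a cochain on an open cover assigns to each    *)
(* (i, j, k) a locally constant function on dom i `&` dom j `&` dom k.        *)
Definition locally_constant (X : topologicalType) (T : Type) (D : set X)
    (f : X -> T) := forall x, D x -> \forall y \near x, f y = f x.

Record cech2 (X : topologicalType) := Cech2 {
  cidx : Type;
  cdom : cidx -> set X;
  cval : cidx -> cidx -> cidx -> X -> 'F_2;
  cdom_open : forall i, open (cdom i);
  cdom_cover : forall x, exists i, cdom i x;
  cval_cst : forall i j k,
    locally_constant (cdom i `&` cdom j `&` cdom k) (cval i j k);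
  cval_cocycle : forall i j k l x,
    cdom i x -> cdom j x -> cdom k x -> cdom l x ->
    cval j k l x - cval i k l x + cval i j l x - cval i j k x = 0
}.
Arguments cidx {X} _.
Arguments cdom {X} _ _ _.
Arguments cval {X} _ _ _ _ _.

(* Equality in the colimit over open covers: c and c' become cohomologous on  *)
(* a common refinement (W, r, r').                                            *)
Definition cohomologous (X : topologicalType) (c c' : cech2 X) :=
  exists (I : Type) (W : I -> set X) (r : I -> cidx c) (r' : I -> cidx c')
      (b : I -> I -> X -> 'F_2),
    [/\ forall i, open (W i), forall x, exists i, W i x,
        forall i, W i `<=` cdom c (r i) `&` cdom c' (r' i),
        forall i j, locally_constant (W i `&` W j) (b i j) &
        forall i j k x, W i x -> W j x -> W k x ->
          cval c' (r' i) (r' j) (r' k) x - cval c (r i) (r j) (r k) x =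
          b j k x - b i k x + b i j x].

(* Spin(3): the unit quaternions of R^3 with its standard structure. *)
Definition dot3 (R : realType) (u v : 'rV[R]_3) : R := (u *m v^T) 0 0.

Definition cross3 (R : realType) (u v : 'rV[R]_3) : 'rV[R]_3 :=
  \row_k (u 0 (k + 1) * v 0 (k + 2) - u 0 (k + 2) * v 0 (k + 1)).

Definition qmul3 (R : realType) := qmul (@dot3 R) (@cross3 R).

(* c is the cocycle obtained from: an open cover, oriented isometric          *)
(* trivialisations th i over its members, and continuous lifts                *)
(* q i j : dom i `&` dom j -> Spin(3) of their SO(3)-valued transition        *)
(* functions, th i = Ad(q i j) \o th j.                                       *)
Definition spin_cocycle (R : realType) (X : topologicalType)
    (A : oe3bundle R X) (c : cech2 X) :=
  exists (th : cidx c -> forall x, 'Hom(fib A x, 'rV[R]_3))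
         (q : cidx c -> cidx c -> X -> (R^o * 'rV[R]_3)%type),
  [/\ forall i a x, cdom c i x -> dom A a x ->
        hcont x (fun y => (th i y \o frame A a y)%VF),
      forall i x, cdom c i x ->
        (forall u v, dot3 (th i x u) (th i x v) = ip A u v) /\
        (exists2 e, pos A x e & forall k, th i x (tnth e k) = delta_mx 0 k),
      forall i j x, cdom c i x -> cdom c j x ->
        [/\ vcont x (q i j), (q i j x).1 ^+ 2 +
            dot3 (q i j x).2 (q i j x).2 = 1 &
            forall v, qmul3 (0, th i x v) (q i j x) =
                      qmul3 (q i j x) (0, th j x v)] &
      forall i j k x, cdom c i x -> cdom c j x -> cdom c k x ->
        qmul3 (q i j x) (q j k x) = (-1) ^+ (cval c i j k x) *: q i k x].

(* The second Stiefel-Whitney class of an oriented bundle of rank 3, as the   *)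
(* image of the class of the bundle under the connecting map                  *)
(*   H^1(X; SO(3)) -> H^2(X; Z/2)                                             *)
(* of the extension Z/2 -> Spin(3) -> SO(3).  A class in H^2(X; Z/2) is the   *)
(* set of all cocycles representing it.                                       *)
Definition w2 (R : realType) (X : topologicalType) (A : oe3bundle R X) :
    set (cech2 X) :=
  [set c | exists2 c0, spin_cocycle A c0 & cohomologous c0 c].

(* Main.v *)
From HB Require Import structures.
From mathcomp Require Import all_boot all_order all_algebra.
From mathcomp Require Import all_classical all_reals all_analysis.
From mathcomp Require Import ring lra.
Require Import Defs.

(** Locally both bundles of quaternion algebras are trivial, and a bundle [M] with
  End M isomorphic to the tensor product of the first with the opposite of the
  second is a bundle of bimodules, locally isomorphic to the quaternions acting
  on themselves from both sides.  The automorphisms of this bimodule are the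
  nonzero reals, and the sign of these reals is all that matters.

  Suppose that Spin(3)-valued lifts [p i j], [q i j] of the transition functions
  of the two bundles are given; their products fail to be cocycles by signs
  [c i j k] and [d i j k], which represent the two classes w_2.  If [M] exists,
  then locally choose a nonzero vector [m i] that is central, [a m = m a] for
  all quaternions [a]; such vectors form a line ([central_line]) and are found
  by averaging ([local_central]).  On overlaps [conj (p i j) * m j * q i j]
  is again central ([central_change]), so it equals [lam i j] times [m i]; the
  signs of the functions [lam i j] exhibit [d - c] as a coboundary
  ([morita_cohomologous]).  Conversely, if [d - c] is a coboundary, then after a
  change of signs the [p i j] and the [q i j] have the same defect, so the maps
  [h |-> p i j * h * conj (q i j)] satisfy the cocycle condition and glue copies
  of the quaternions to a bundle on which the two algebra bundles act from the
  left and from the right ([glue_morita]).  The action reaches all endomorphisms,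
  and is therefore an isomorphism by dimension count.

  Both directions need spin cocycles to exist ([spin_cocycle_exists]), and here
  the compactness of [X] is used: Gram-Schmidt gives local orthonormal frames,
  the Skolem-Noether theorem in the averaged form ([averagingP]) gives
  continuous lifts of their transition functions near each point, and a shrinking
  argument makes these lifts defined on whole intersections.  The transitivity of
  [cohomologous] then yields equality of the classes as sets of cocycles. *)

Set Implicit Arguments.
Unset Strict Implicit.
Unset Printing Implicit Defensive.

Import Order.TTheory GRing.Theory Num.Theory.
Import numFieldNormedType.Exports.

Local Open Scope classical_set_scope.
Local Open Scope ring_scope.

(** * Quaternions *)

Section Lin.
Context {R : realType}.

Definition lin_of (V W : vectType R) (f : V -> W) (lf : linear f) : 'Hom(V, W) :=
  linfun (HB.pack f (GRing.isLinear.Build _ _ _ _ f lf) : {linear V -> W}).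

Lemma lin_ofE (V W : vectType R) (f : V -> W) (lf : linear f) v :
  lin_of lf v = f v.
Proof. by rewrite lfunE. Qed.

End Lin.

Section Quat.
Context {R : realType}.

(** A copy of the model fibre of the quaternion bundles, so that it can carry a
  ring structure of its own. *)
Definition quat : Type := (R^o * 'rV[R]_3)%type.
HB.instance Definition _ := Vector.copy quat (R^o * 'rV[R]_3)%type.

Implicit Types p q r : quat.

Definition q4 (a b c d : R) : quat :=
  (a, \row_k (if k == 0 then b else if k == 1 then c else d)).

Definition qre q : R := q.1.
Definition qi q : R := q.2 0 0.
Definition qj q : R := q.2 0 1.
Definition qk q : R := q.2 0 2.

#[global] Arguments qre : simpl never.
#[global] Arguments qi : simpl never.
#[global] Arguments qj : simpl never.
#[global] Arguments qk : simpl never.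

Lemma rV3P (u v : 'rV[R]_3) :
  u 0 0 = v 0 0 -> u 0 1 = v 0 1 -> u 0 2 = v 0 2 -> u = v.
Proof.
move=> e0 e1 e2; apply/rowP => -[[|[|[|//]]] lt].
- by rewrite (_ : Ordinal lt = 0) //; apply/val_inj.
- by rewrite (_ : Ordinal lt = 1) //; apply/val_inj.
- by rewrite (_ : Ordinal lt = 2) //; apply/val_inj.
Qed.

Lemma quatP p q :
  qre p = qre q -> qi p = qi q -> qj p = qj q -> qk p = qk q -> p = q.
Proof.
case: p q => [a u] [b v] /= h0 h1 h2 h3; congr pair => //.
exact: rV3P.
Qed.

Lemma dot3E (u v : 'rV[R]_3) :
  dot3 u v = u 0 0 * v 0 0 + u 0 1 * v 0 1 + u 0 2 * v 0 2.
Proof.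
rewrite /dot3 mxE !big_ord_recl big_ord0 !mxE addr0 addrA.
by congr (_ * _ + _ * _ + _ * _); congr (_ 0 _); apply/val_inj.
Qed.

Let mul p q : quat := qmul3 p q.

Let mulE0 p q :
  (qre (mul p q) = qre p * qre q - qi p * qi q - qj p * qj q - qk p * qk q) *
  (qi (mul p q) = qre p * qi q + qi p * qre q + qj p * qk q - qk p * qj q) *
  (qj (mul p q) = qre p * qj q + qj p * qre q + qk p * qi q - qi p * qk q) *
  (qk (mul p q) = qre p * qk q + qk p * qre q + qi p * qj q - qj p * qi q).
Proof.
split; [split; [split|]|].
- by rewrite /qre /= dot3E /qi /qj /qk; ring.
- rewrite /qi /= !mxE /qre /qj /qk.
  have -> : (0 + 1 : 'I_3) = 1 by apply/val_inj.
  have -> : (0 + 2 : 'I_3) = 2 by apply/val_inj.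
  by ring.
- rewrite /qj /= !mxE /qre /qi /qk.
  have -> : (1 + 1 : 'I_3) = 2 by apply/val_inj.
  have -> : (1 + 2 : 'I_3) = 0 by apply/val_inj.
  by ring.
- rewrite /qk /= !mxE /qre /qi /qj.
  have -> : (2 + 1 : 'I_3) = 0 by apply/val_inj.
  have -> : (2 + 2 : 'I_3) = 1 by apply/val_inj.
  by ring.
Qed.

Lemma qaddE p q :
  (qre (p + q) = qre p + qre q) * (qi (p + q) = qi p + qi q) *
  (qj (p + q) = qj p + qj q) * (qk (p + q) = qk p + qk q).
Proof. by split; [split; [split|]|]; rewrite /qre /qi /qj /qk //= mxE. Qed.

Lemma qoppE p :
  (qre (- p) = - qre p) * (qi (- p) = - qi p) *
  (qj (- p) = - qj p) * (qk (- p) = - qk p).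
Proof. by split; [split; [split|]|]; rewrite /qre /qi /qj /qk //= mxE. Qed.

Lemma qscaleE (a : R) p :
  (qre (a *: p) = a * qre p) * (qi (a *: p) = a * qi p) *
  (qj (a *: p) = a * qj p) * (qk (a *: p) = a * qk p).
Proof. by split; [split; [split|]|]; rewrite /qre /qi /qj /qk //= mxE. Qed.

Lemma q4E a b c d :
  (qre (q4 a b c d) = a) * (qi (q4 a b c d) = b) *
  (qj (q4 a b c d) = c) * (qk (q4 a b c d) = d).
Proof. by split; [split; [split|]|]; rewrite /qre /qi /qj /qk //= mxE. Qed.

Lemma qzeroE :
  (qre 0 = 0) * (qi 0 = 0) * (qj 0 = 0) * (qk 0 = 0).
Proof. by split; [split; [split|]|]; rewrite /qre /qi /qj /qk //= mxE. Qed.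

Let one : quat := (1, 0).

Let oneE0 :
  (qre one = 1) * (qi one = 0) * (qj one = 0) * (qk one = 0).
Proof. by split; [split; [split|]|]; rewrite /qre /qi /qj /qk //= mxE. Qed.

Let mulA : associative mul.
Proof. by move=> p q r; apply: quatP; rewrite !mulE0; ring. Qed.
Let mul1q : left_id one mul.
Proof. by move=> p; apply: quatP; rewrite !mulE0 !oneE0; ring. Qed.
Let mulq1 : right_id one mul.
Proof. by move=> p; apply: quatP; rewrite !mulE0 !oneE0; ring. Qed.
Let mulDl : left_distributive mul +%R.
Proof. by move=> p q r; apply: quatP; rewrite !(mulE0, qaddE); ring. Qed.
Let mulDr : right_distributive mul +%R.
Proof. by move=> p q r; apply: quatP; rewrite !(mulE0, qaddE); ring. Qed.
Let one_neq0 : one != 0.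
Proof.
apply/eqP => /(congr1 (fun q : quat => qre q)); rewrite oneE0 qzeroE.
by apply/eqP; rewrite oner_eq0.
Qed.

HB.instance Definition _ := GRing.Zmodule_isNzRing.Build quat
  mulA mul1q mulq1 mulDl mulDr one_neq0.

Let scaleAl (a : R) p q : a *: (p * q) = (a *: p) * q.
Proof. by apply: quatP; rewrite !(mulE0, qscaleE); ring. Qed.
HB.instance Definition _ := GRing.Lmodule_isLalgebra.Build R quat scaleAl.
Let scaleAr (a : R) p q : a *: (p * q) = p * (a *: q).
Proof. by apply: quatP; rewrite !(mulE0, qscaleE); ring. Qed.
HB.instance Definition _ := GRing.Lalgebra_isAlgebra.Build R quat scaleAr.

Lemma mulqE p q : p * q = qmul3 p q. Proof. by []. Qed.

Lemma qmulE p q :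
  (qre (p * q) = qre p * qre q - qi p * qi q - qj p * qj q - qk p * qk q) *
  (qi (p * q) = qre p * qi q + qi p * qre q + qj p * qk q - qk p * qj q) *
  (qj (p * q) = qre p * qj q + qj p * qre q + qk p * qi q - qi p * qk q) *
  (qk (p * q) = qre p * qk q + qk p * qre q + qi p * qj q - qj p * qi q).
Proof. exact: mulE0. Qed.

Lemma qoneE :
  (qre 1 = 1) * (qi 1 = 0) * (qj 1 = 0) * (qk 1 = 0).
Proof. exact: oneE0. Qed.

Definition qE := (qmulE, qoneE, qaddE, qoppE, qscaleE, qzeroE, q4E).

Definition qb (p : 'I_4) : quat :=
  q4 (p == 0)%:R (p == 1)%:R (p == 2)%:R (p == 3)%:R.

Definition qconj (q : quat) : quat := (q.1, - q.2).

#[global] Arguments qb : simpl never.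
#[global] Arguments qconj : simpl never.

Lemma qconjE q :
  (qre (qconj q) = qre q) * (qi (qconj q) = - qi q) *
  (qj (qconj q) = - qj q) * (qk (qconj q) = - qk q).
Proof. by split; [split; [split|]|]; rewrite /qre /qi /qj /qk //= mxE. Qed.

Definition qnorm2 (q : quat) : R := q.1 ^+ 2 + dot3 q.2 q.2.

Lemma qnorm2E q : qnorm2 q = qre q ^+ 2 + qi q ^+ 2 + qj q ^+ 2 + qk q ^+ 2.
Proof. by rewrite /qnorm2 dot3E /qre /qi /qj /qk; ring. Qed.

Lemma qconjM p q : qconj (p * q) = qconj q * qconj p.
Proof. by apply: quatP; rewrite !(qconjE, qE); ring. Qed.

Lemma mulq_conj q : q * qconj q = qnorm2 q *: 1.
Proof. by rewrite qnorm2E; apply: quatP; rewrite !(qconjE, qE); ring. Qed.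

Lemma mulq_conjl q : qconj q * q = qnorm2 q *: 1.
Proof. by rewrite qnorm2E; apply: quatP; rewrite !(qconjE, qE); ring. Qed.

Lemma sum4 (V : nmodType) (F : 'I_4 -> V) :
  \sum_(p < 4) F p = F 0 + F 1 + F 2 + F 3.
Proof.
rewrite !big_ord_recl big_ord0 addr0 !addrA.
by congr (F _ + F _ + F _ + F _); apply/val_inj.
Qed.

Lemma qbE : (qb 0 = q4 1 0 0 0) * (qb 1 = q4 0 1 0 0) *
  (qb 2 = q4 0 0 1 0) * (qb 3 = q4 0 0 0 1).
Proof. by []. Qed.

(** Averaging [h] over conjugation by the group generated by [i], [j], [k] leaves
  only its central part. *)
Lemma sum_sandwich h : \sum_p qb p * h * qconj (qb p) = (4 * qre h) *: 1.
Proof. by rewrite sum4 !qbE; apply: quatP; rewrite !(qconjE, qE); ring. Qed.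

Lemma quat_decomp h : h = \sum_r qre (h * qconj (qb r)) *: qb r.
Proof. by rewrite sum4 !qbE; apply: quatP; rewrite !(qconjE, qE); ring. Qed.

Lemma center_real (h : quat) : (forall a : quat, a * h = h * a) -> h = qre h *: 1.
Proof.
move=> hc.
have := congr1 qj (hc (qb 1)); rewrite qbE !qE => e1.
have := congr1 qk (hc (qb 1)); rewrite qbE !qE => e2.
have := congr1 qk (hc (qb 2)); rewrite qbE !qE => e3.
by apply: quatP; rewrite !qE; lra.
Qed.

Lemma qnorm2M p q : qnorm2 (p * q) = qnorm2 p * qnorm2 q.
Proof. by rewrite !qnorm2E !qE; ring. Qed.

Lemma qnorm2Z a q : qnorm2 (a *: q) = a ^+ 2 * qnorm2 q.
Proof. by rewrite !qnorm2E !qE; ring. Qed.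

Lemma qnorm2_ge0 q : 0 <= qnorm2 q.
Proof. by rewrite qnorm2E !addr_ge0 ?sqr_ge0. Qed.

Lemma qnorm2_eq0 q : (qnorm2 q == 0) = (q == 0).
Proof.
apply/eqP/eqP => [|->]; last by rewrite qnorm2E !qE; ring.
move/eqP; rewrite qnorm2E !paddr_eq0 ?addr_ge0 ?sqr_ge0 // !sqrf_eq0.
by move=> /andP[/andP[/andP[/eqP ? /eqP ?] /eqP ?] /eqP ?]; apply: quatP; rewrite !qE.
Qed.

Lemma qconj_intertwine (q a b : quat) : qnorm2 q = 1 -> a * q = q * b ->
  qconj q * a = b * qconj q.
Proof.
move=> nq1 h; have : qconj q * (a * q) * qconj q = qconj q * (q * b) * qconj q.
  by rewrite h.
by rewrite !mulrA mulq_conjl nq1 scale1r mul1r -!mulrA mulq_conj nq1 scale1r mulr1.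
Qed.

Lemma qre_mulC p q : qre (p * q) = qre (q * p).
Proof. by rewrite !qE; ring. Qed.

Lemma quat_decomp_conj h : h = \sum_r qre (h * qb r) *: qconj (qb r).
Proof. by rewrite sum4 !qbE; apply: quatP; rewrite !(qconjE, qE); ring. Qed.

(** The Casimir element, the sum of [e (x) conj e] over the basis, absorbs a
  quaternion [h] equally on either side: by trace symmetry both sums have the
  coefficients [Re (h e_p conj e_r)].  It is stated for the bilinear maps in
  which it is evaluated below: the multiplications that give the
  Skolem-Noether theorem, and the action on a bimodule. *)
Lemma casimir (Z : vectType R) (B : quat -> quat -> Z) h : bilin B ->
  \sum_p B (h * qb p) (qconj (qb p)) = \sum_p B (qb p) (qconj (qb p) * h).
Proof.
move=> [Bl Br].
transitivity (\sum_p \sum_r qre (h * qb p * qconj (qb r)) *: B (qb r) (qconj (qb p))).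
  apply: eq_bigr => p _; rewrite {1}(quat_decomp (h * qb p)).
  exact: (linear_sumE _ _ _ (Bl _)).
rewrite exchange_big; apply: eq_bigr => r _ /=.
rewrite [X in B _ X]quat_decomp_conj (linear_sumE _ _ _ (Br _)).
by apply: eq_bigr => p _; rewrite qre_mulC mulrA.
Qed.

(** The Skolem-Noether theorem for an endomorphism [phi], by averaging: the
  Casimir element turns any [a] into an intertwiner of [phi] and the identity.
  The formula is linear in the values of [phi], so that the intertwiner
  depends continuously on [phi]. *)
Section Averaging.
Variable phi : quat -> quat.
Hypotheses (lphi : linear phi) (phi1 : phi 1 = 1)
  (phiM : forall p q : quat, phi (p * q) = phi p * phi q).

Definition averaging (a : quat) : quat := \sum_p phi (qb p) * a * qconj (qb p).

Lemma averagingP a h : phi h * averaging a = averaging a * h.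
Proof.
have bB : bilin (fun x y : quat => phi x * a * y).
  split=> [w|v] s u1 u2; first by rewrite lphi !mulrDl -!scalerAl.
  by rewrite mulrDr scalerAr.
have := casimir h bB.
rewrite [LHS](_ : _ = phi h * averaging a); last first.
  by rewrite mulr_sumr; apply: eq_bigr => p _; rewrite phiM !mulrA.
by move=> ->; rewrite mulr_suml; apply: eq_bigr => p _; rewrite !mulrA.
Qed.

Lemma qre_sum (I : Type) (r : seq I) (F : I -> quat) :
  qre (\sum_(i <- r) F i) = \sum_(i <- r) qre (F i).
Proof. by elim/big_rec2: _ => [|i x y _ <-]; rewrite !qE. Qed.

(** Some basis quaternion gives a nonzero intertwiner, since the trace of
  [averaging] as a linear map is four times the real part of [phi 1]. *)
Lemma averaging_neq0 : exists r : 'I_4, averaging (qb r) != 0.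
Proof.
apply/existsP; rewrite -negb_forall; apply/negP => /forallP /= T0.
have : \sum_(r < 4) qre (averaging (qb r) * qconj (qb r)) = 4.
  transitivity (\sum_(p < 4) qre (phi (qb p) *
      \sum_(r < 4) qb r * qconj (qb p) * qconj (qb r))).
    under eq_bigr do rewrite mulr_suml qre_sum.
    rewrite exchange_big; apply: eq_bigr => p _.
    by rewrite mulr_sumr qre_sum; apply: eq_bigr => r _; rewrite !mulrA.
  under eq_bigr do rewrite sum_sandwich -scalerAr mulr1 qscaleE.
  by rewrite sum4 !qbE !(qconjE, qE) [q4 1 0 0 0](_ : _ = 1) ?phi1 ?qoneE;
    [ring | apply: quatP; rewrite !qE].
rewrite big1 => [/eqP|r _]; first by rewrite eq_sym pnatr_eq0.
by move: (T0 r) => /eqP ->; rewrite mul0r qzeroE.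
Qed.

End Averaging.

End Quat.
Arguments quat : clear implicits.

(** * Continuity of families of vectors *)

Section Cont.
Context {R : realType} {X : topologicalType}.
Implicit Types V W Z : vectType R.

Lemma vcont_near W x (f g : X -> W) :
  (\forall y \near x, f y = g y) -> vcont x f -> vcont x g.
Proof.
move=> fg cf l; have := cf l; rewrite /continuous_at.
rewrite (nbhs_singleton fg); apply: cvg_trans; apply: near_eq_cvg.
by apply: filterS fg => y ->.
Qed.

Lemma hcont_near V W x (S T : X -> 'Hom(V, W)) :
  (\forall y \near x, S y = T y) -> hcont x S -> hcont x T.
Proof.
move=> ST cS v; apply: vcont_near (cS v).
by apply: filterS ST => y ->.
Qed.

Lemma vcont_lin V W (L : V -> W) x (f : X -> V) :
  linear L -> vcont x f -> vcont x (fun y => L (f y)).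
Proof.
move=> lL cf l; have := cf (l \o lin_of lL)%VF.
by under eq_fun do rewrite comp_lfunE lin_ofE.
Qed.

Lemma vcontR x (f : X -> R) : vcont x (f : X -> R^o) <-> continuous_at x f.
Proof.
split=> [cf|cf l].
  have /= := cf (\1%VF); by under eq_fun do rewrite id_lfunE.
have -> : (fun y => l (f y) : R) = (fun y => f y * l 1 : R).
  by apply/funext => y; rewrite -[X in l X]mulr1 -[X in l X]/(f y *: (1 : R^o)) linearZ.
by apply: cvgM; [exact: cf | exact: cvg_cst].
Qed.

Lemma vcont_bilin V W Z (B : V -> W -> Z) x (f : X -> V) (g : X -> W) :
  bilin B -> vcont x f -> vcont x g -> vcont x (fun y => B (f y) (g y)).
Proof.
move=> bB cf cg.
pose e i := (vbasis {:V})`_i; pose e' j := (vbasis {:W})`_j.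
have -> : (fun y => B (f y) (g y)) = fun y => \sum_i \sum_j
    (coord (vbasis {:V}) i (f y) * coord (vbasis {:W}) j (g y)) *: B (e i) (e' j).
  apply/funext => y; rewrite -(tliftE _ _ bB).
  by apply: eq_bigr => i _; apply: eq_bigr => j _; rewrite mxE.
apply: vcont_sum => i; apply: vcont_sum => j.
by apply: vcontZ; [apply: cvgM; exact: vcont_coord | exact: vcont_cst].
Qed.

Lemma vcont_bilinR V W (B : V -> W -> R^o) x (f : X -> V) (g : X -> W) :
  bilin B -> vcont x f -> vcont x g ->
  continuous_at x (fun y => B (f y) (g y) : R).
Proof. by move=> bB cf cg; apply/vcontR; exact: vcont_bilin. Qed.

Lemma vcont_linR V (L : V -> R^o) x (f : X -> V) :
  linear L -> vcont x f -> continuous_at x (fun y => L (f y) : R).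
Proof. by move=> lL cf; apply/vcontR; exact: vcont_lin. Qed.

Lemma vcont_row n x (f : X -> 'rV[R]_n) :
  (forall k, continuous_at x (fun y => f y 0 k)) -> vcont x f.
Proof.
move=> cf; have -> : f = fun y => \sum_k f y 0 k *: delta_mx 0 k.
  by apply/funext => y; exact: row_sum_delta.
by apply: vcont_sum => k; apply: vcontZ; [exact: cf | exact: vcont_cst].
Qed.

Lemma vcont_entry n x (f : X -> 'rV[R]_n) k :
  vcont x f -> continuous_at x (fun y => f y 0 k).
Proof.
move=> cf; apply: (@vcont_linR 'rV[R]_n (fun u => u 0 k)) => //.
by move=> a u v; rewrite !mxE.
Qed.

Lemma continuous_gt0 x (f : X -> R) :
  continuous_at x f -> 0 < f x -> \forall y \near x, 0 < f y.
Proof. by move=> cf f0; apply: (cvgr_gt (f x) cf). Qed.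

Lemma vcont_neq0 W x (f : X -> W) :
  vcont x f -> f x != 0 -> \forall y \near x, f y != 0.
Proof.
move=> cf f0.
have [k fk] : exists k, coord (vbasis {:W}) k (f x) != 0.
  apply/existsP; rewrite -negb_forall; apply: contra f0 => /forallP /= f0k.
  rewrite (coord_vbasis (memvf (f x))) big1 // => k _.
  by rewrite (eqP (f0k k)) scale0r.
have ck := vcont_coord (k := k) cf.
have : \forall y \near x, 0 < `|coord (vbasis {:W}) k (f y)|.
  apply: (@continuous_gt0 x (fun y => `|coord (vbasis {:W}) k (f y)|)).
    exact: (cvg_norm ck).
  by rewrite normr_gt0.
apply: filterS => y; rewrite normr_gt0; apply: contra => /eqP ->.
by rewrite linear0.
Qed.

Lemma bilin_mulq : bilin (fun p q : quat R => p * q).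
Proof.
by split=> [q|p] a u v; rewrite ?mulrDl ?mulrDr -?scalerAl -?scalerAr.
Qed.

Lemma vcont_mulq x (f g : X -> quat R) :
  vcont x f -> vcont x g -> vcont x (fun y => f y * g y).
Proof. exact: vcont_bilin bilin_mulq. Qed.

Lemma linear_qconj : linear (@qconj R).
Proof. by move=> a p q; apply: quatP; rewrite !(qconjE, qE); ring. Qed.

Lemma vcont_qconj x (f : X -> quat R) :
  vcont x f -> vcont x (fun y => qconj (f y)).
Proof. exact: vcont_lin linear_qconj. Qed.

Lemma linear_qre : linear (@qre R : quat R -> R^o).
Proof. by move=> a p q; rewrite !qE. Qed.

Lemma vcont_qre x (f : X -> quat R) :
  vcont x f -> continuous_at x (fun y => qre (f y)).
Proof. exact: vcont_linR linear_qre. Qed.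

Lemma vcont_qnorm2 x (f : X -> quat R) :
  vcont x f -> continuous_at x (fun y => qnorm2 (f y)).
Proof.
move=> cf; have -> : (fun y => qnorm2 (f y)) = (fun y => qre (f y * qconj (f y))).
  by apply/funext => y; rewrite mulq_conj qE qoneE mulr1.
by apply: vcont_qre; apply: vcont_mulq => //; exact: vcont_qconj.
Qed.

Definition normalise (q : quat R) : quat R := (Num.sqrt (qnorm2 q))^-1 *: q.

Lemma qnorm2_normalise q : q != 0 -> qnorm2 (normalise q) = 1.
Proof.
move=> q0; rewrite qnorm2Z exprVn sqr_sqrtr ?qnorm2_ge0 // mulVf //.
by rewrite qnorm2_eq0.
Qed.

Lemma vcont_normalise x (f : X -> quat R) :
  vcont x f -> f x != 0 -> vcont x (fun y => normalise (f y)).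
Proof.
move=> cf f0; apply: vcontZ => //.
have s0 : Num.sqrt (qnorm2 (f x)) != 0.
  by rewrite sqrtr_eq0 -ltNge lt_neqAle eq_sym qnorm2_eq0 f0 qnorm2_ge0.
apply: cvgV => //.
by apply: (continuous_comp (vcont_qnorm2 cf)); exact: sqrt_continuous.
Qed.

Lemma near_dom (F : vectType R) (E : vbundle X F) i x :
  dom E i x -> \forall y \near x, dom E i y.
Proof. by move=> dx; apply: open_nbhs_nbhs; split=> //; exact: dom_open. Qed.

End Cont.

(** * Oriented orthonormal frames *)

Section Basis.
Context {R : realType} {V : vectType R} {n : nat}.

Lemma basis_mx (t : 'Hom(V, 'rV[R]_n)) (f : n.-tuple V) :
  injective t -> \dim {:V} = n ->
  \det (\matrix_(k, l) t (tnth f k) 0 l) != 0 -> basis_of {:V} f.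
Proof.
move=> tI dV; set N := \matrix_(k, l) _ => d0.
have uN : N \in unitmx by rewrite unitmxE unitfE.
rewrite basisEdim size_tuple dV leqnn andbT.
apply/subvP => v _; pose c := t v *m invmx N.
have -> : v = \sum_k c 0 k *: tnth f k.
  apply: tI; rewrite linear_sum -[LHS](mulmxKV uN) -/c mulmx_sum_row.
  apply: eq_bigr => k _; rewrite linearZ /=; congr (_ *: _).
  by apply/rowP => l; rewrite !mxE.
apply: memv_suml => k _; apply: memvZ; apply: memv_span; exact: mem_tnth.
Qed.

Lemma coord_mx (t : 'Hom(V, 'rV[R]_n)) (e : n.-tuple V) :
  injective t -> basis_of {:V} e -> (forall k, t (tnth e k) = delta_mx 0 k) ->
  forall l v, coord e l v = t v 0 l.
Proof.
move=> tI be te l v.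
have {1}-> : v = \sum_j t v 0 j *: e`_j.
  apply: tI; rewrite linear_sum [LHS]row_sum_delta.
  by apply: eq_bigr => j _; rewrite linearZ /= -tnth_nth te.
by rewrite coord_sum_free //; exact: basis_free be.
Qed.

Definition bmx (e f : n.-tuple V) : 'M[R]_n := \matrix_(k, l) coord e l (tnth f k).

Lemma bmx_comp (e f g : n.-tuple V) : basis_of {:V} f ->
  bmx e g = bmx f g *m bmx e f.
Proof.
move=> bf; apply/matrixP => k l; rewrite !mxE.
rewrite {1}(coord_basis bf (memvf (tnth g k))) linear_sum.
by apply: eq_bigr => j _; rewrite !mxE linearZ /= -tnth_nth.
Qed.

Lemma bmx_id (e : n.-tuple V) : basis_of {:V} e -> bmx e e = 1%:M.
Proof.
move=> be; apply/matrixP => k l; rewrite !mxE (tnth_nth 0).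
by rewrite coord_free ?(basis_free be) // eq_sym.
Qed.

End Basis.

Section Det3.
Context {R : realType}.

Lemma det2E (M : 'M[R]_2) : \det M = M 0 0 * M 1 1 - M 0 1 * M 1 0.
Proof.
rewrite (expand_det_row _ 0) !big_ord_recl big_ord0 /cofactor !det_mx11 !mxE.
rewrite addr0 !expr0 !mul1r.
have -> : lift 0 0 = 1 :> 'I_2 by apply/val_inj.
have -> : lift 1 0 = 0 :> 'I_2 by apply/val_inj.
by rewrite expr1 mulN1r mulrN.
Qed.

Lemma det3E (M : 'M[R]_3) : \det M = dot3 (cross3 (row 0 M) (row 1 M)) (row 2 M).
Proof.
rewrite (expand_det_row _ 2) !big_ord_recl big_ord0 /cofactor !det2E !mxE.
rewrite dot3E !mxE addr0 /=.
have e0 : lift 2 0 = 0 :> 'I_3 by apply/val_inj.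
have e1 : lift 2 1 = 1 :> 'I_3 by apply/val_inj.
have e2 : lift 0 0 = 1 :> 'I_3 by apply/val_inj.
have e3 : lift 0 1 = 2 :> 'I_3 by apply/val_inj.
have e4 : lift 1 0 = 0 :> 'I_3 by apply/val_inj.
have e5 : lift 1 1 = 2 :> 'I_3 by apply/val_inj.
have f1 : (0 + 2 : 'I_3) = 2 by apply/val_inj.
have f2 : (1 + 1 : 'I_3) = 2 by apply/val_inj.
have f3 : (1 + 2 : 'I_3) = 0 by apply/val_inj.
have f4 : (2 + 1 : 'I_3) = 0 by apply/val_inj.
have f5 : (2 + 2 : 'I_3) = 1 by apply/val_inj.
have f6 : (0 + 1 : 'I_3) = 1 by apply/val_inj.
have g0 : ord0 = 0 :> 'I_3 by [].
have g2 : lift ord0 (lift ord0 ord0) = 2 :> 'I_3 by apply/val_inj.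
have h0 : ((1 %% 3 + 1 %% 3) %% 3 + 0 = 2)%N by [].
have h1 : ((1 %% 3 + 1 %% 3) %% 3 + bump 0 0 = 3)%N by [].
have h2 : ((1 %% 3 + 1 %% 3) %% 3 + bump 0 (bump 0 0) = 4)%N by [].
rewrite !(g2, h0, h1, h2, e0, e1, e2, e3, e4, e5, f1, f2, f3, f4, f5, f6, g0).
ring.
Qed.

End Det3.

Section Frame.
Context {R : realType} {X : topologicalType} {A : oe3bundle R X} {x : X}.

(** An oriented isometry of the fibre onto R^3. *)
Definition oframe (t : 'Hom(fib A x, 'rV[R]_3)) :=
  (forall u v, dot3 (t u) (t v) = ip A u v) /\
  (exists2 e, pos A x e & forall k, t (tnth e k) = delta_mx 0 k).

Lemma bilin_dot3 : bilin (@dot3 R : _ -> _ -> R^o).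
Proof. by split=> [w|v] a u1 u2; rewrite !dot3E !mxE /GRing.scale /=; ring. Qed.

Variables (t : 'Hom(fib A x, 'rV[R]_3)) (ht : oframe t).

Lemma oframe_inj : injective t.
Proof.
move=> u v tuv; apply/eqP; rewrite -subr_eq0; apply/negPn/negP => /ip_pos.
by rewrite -ht.1 linearB /= tuv subrr dot3E !mxE !mulr0 !addr0 ltxx.
Qed.

Lemma oframe_surj w : exists v, t v = w.
Proof.
have [e _ te] := ht.2; exists (\sum_k w 0 k *: tnth e k).
rewrite linear_sum [RHS]row_sum_delta; apply: eq_bigr => k _.
by rewrite linearZ /= te.
Qed.

Lemma oframeK : cancel t (t^-1)%VF.
Proof. by apply/lker0_lfunK/lker0P; exact: oframe_inj. Qed.

Lemma oframeVK : cancel (t^-1)%VF t.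
Proof. by move=> w; have [v <-] := oframe_surj w; rewrite oframeK. Qed.

Lemma oframe_dim : \dim {:fib A x} = 3.
Proof. by have [e pe _] := ht.2; rewrite (size_basis (pos_basis pe)). Qed.

Let N (f : 3.-tuple (fib A x)) : 'M[R]_3 := \matrix_(k, l) t (tnth f k) 0 l.

Let rowN f k : row k (N f) = t (tnth f k).
Proof. by apply/rowP => l; rewrite !mxE. Qed.

Let gramN f : \matrix_(k, l) ip A (tnth f k) (tnth f l) = N f *m (N f)^T.
Proof.
apply/matrixP => k l; rewrite !mxE -ht.1 /dot3 mxE.
by apply: eq_bigr => j _; rewrite !mxE.
Qed.

Let posN f : pos A x f <-> 0 < \det (N f).
Proof.
have [e pe te] := ht.2; have be := pos_basis pe.
have NE : bmx e f = N f.
  by apply/matrixP => k l; rewrite !mxE (coord_mx oframe_inj be te).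
split=> [pf|dN].
  by have := (pos_det pe (pos_basis pf)).1 pf; rewrite -/(bmx e f) NE.
have bf : basis_of {:fib A x} f.
  by apply: (basis_mx oframe_inj oframe_dim); rewrite gt_eqF.
by apply/(pos_det pe bf); rewrite -/(bmx e f) NE.
Qed.

(** The Gram determinant is the square of the determinant of the coordinates,
  and [vol] restores the sign that its square root loses. *)
Lemma volE u v w : vol u v w = dot3 (cross3 (t u) (t v)) (t w).
Proof.
rewrite /vol gramN det_mulmx det_tr -expr2 sqrtr_sqr.
set f := [tuple u; v; w].
have <- : \det (N f) = dot3 (cross3 (t u) (t v)) (t w) by rewrite det3E !rowN.
case: asboolP => [/posN /gtr0_norm ->|nf]; first by rewrite mul1r.
rewrite ler0_norm ?mulN1r ?opprK // leNgt; apply/negP => /posN; exact: nf.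
Qed.

Lemma oframe_cross u v : t (cross u v) = cross3 (t u) (t v).
Proof.
rewrite /cross; set P := [set w | _].
have Pw : P (t^-1 (cross3 (t u) (t v)))%VF.
  by move=> z; rewrite -ht.1 oframeVK volE.
have Puniq w w' : P w -> P w' -> w = w'.
  move=> pw pw'; apply/eqP; rewrite -subr_eq0; apply/negPn/negP => /ip_pos.
  rewrite -{1}[w]scale1r -scaleN1r addrC ip_lin scale1r pw pw' mulN1r addNr.
  by rewrite ltxx.
case: xgetP => [w -> pw|/(_ _ Pw)//].
by rewrite (Puniq _ _ pw Pw) oframeVK.
Qed.

(** An oriented orthonormal frame identifies the fibre of the quaternion bundle
  with the quaternions as an algebra. *)
Lemma rid_mul (p q : R^o * fib A x) :
  rid_lfun t (qmul (@ip R X A x) (@cross R X A x) p q) =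
  (rid_lfun t p : quat R) * (rid_lfun t q : quat R).
Proof.
rewrite !rid_lfunE /= mulqE /qmul3 /qmul /= ht.1.
by rewrite !linearD !linearZ /= oframe_cross.
Qed.

Lemma ridK : cancel (rid_lfun t) (rid_lfun (t^-1)%VF).
Proof. by move=> [s v]; rewrite !rid_lfunE /= oframeK. Qed.

Lemma ridVK : cancel (rid_lfun (t^-1)%VF) (rid_lfun t).
Proof. by move=> [s v]; rewrite !rid_lfunE /= oframeVK. Qed.

End Frame.

(** * The Gram-Schmidt process in a bundle chart *)

Section LocalFrame.
Context {R : realType} {X : topologicalType} {A : oe3bundle R X}.

Lemma bilin_ip x : bilin (fun u v : fib A x => ip A u v : R^o).
Proof.
by split=> [w|v] a u1 u2; [|rewrite !(ip_sym v)]; rewrite ip_lin.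
Qed.

(** Orientation may be tested on any basis, not only on a positive one. *)
Lemma pos_iff x (e f : 3.-tuple (fib A x)) :
  basis_of {:fib A x} e -> basis_of {:fib A x} f ->
  (pos A x f <-> (pos A x e <-> 0 < \det (bmx e f))).
Proof.
move=> be bf; have [g pg] := pos_ex A x; have bg := pos_basis pg.
rewrite (pos_det pg be) (pos_det pg bf) -!/(bmx _ _).
rewrite (bmx_comp g f be) det_mulmx.
have d1 : \det (bmx e g) * \det (bmx g e) = 1.
  by rewrite mulrC -det_mulmx -bmx_comp // bmx_id // det1.
have d2 : \det (bmx f e) * \det (bmx e f) = 1.
  by rewrite mulrC -det_mulmx -bmx_comp // bmx_id // det1.
have n1 : \det (bmx g e) != 0.
  by apply: contra_eq_neq d1 => ->; rewrite mulr0 eq_sym oner_eq0.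
have n2 : \det (bmx e f) != 0.
  by apply: contra_eq_neq d2 => ->; rewrite mulr0 eq_sym oner_eq0.
move: n1 n2; rewrite !neq_lt => /orP[h1|h1] /orP[h2|h2].
- by rewrite nmulr_rgt0 // h1 !ltNge !ltW //; split.
- by rewrite pmulr_rgt0 // h2 ltNge ltW //; split=> // -[_ ->].
- by rewrite nmulr_rgt0 // h1 (ltNge 0) ltW // ltNge ltW //; split => // -[->].
- by rewrite pmulr_rgt0 // h1 h2; split.
Qed.

Variable i : idx A.

Let G y a b := ip A (frame A i y a) (frame A i y b).

Let bilin_G y : bilin (G y : _ -> _ -> R^o).
Proof.
have [Bl Br] := bilin_ip y.
by split=> [w|v] a u1 u2; rewrite /G linearP ?Bl ?Br.
Qed.

Let cont_G x (f g : X -> 'rV[R]_3) : dom A i x -> vcont x f -> vcont x g ->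
  continuous_at x (fun y => G y (f y) (g y)).
Proof.
move=> dx cf cg; apply/vcontR.
have -> : (fun y => G y (f y) (g y) : R^o) = fun y => \sum_k \sum_l
    (f y 0 k * g y 0 l) *: (G y (delta_mx 0 k) (delta_mx 0 l) : R^o).
  apply/funext => y; rewrite {1}[f y]row_sum_delta.
  rewrite (linear_sumE _ _ _ ((bilin_G y).1 _)); apply: eq_bigr => k _.
  rewrite {1}[g y]row_sum_delta (linear_sumE _ _ _ ((bilin_G y).2 _)).
  by rewrite scaler_sumr; apply: eq_bigr => l _; rewrite scalerA.
apply: vcont_sum => k; apply: vcont_sum => l; apply: vcontZ.
  by apply: cvgM; exact: vcont_entry.
by apply/vcontR; exact: ip_cont.
Qed.

Lemma ip_frame_cont x (f g : X -> 'rV[R]_3) :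
  dom A i x -> vcont x f -> vcont x g ->
  continuous_at x (fun y => ip A (frame A i y (f y)) (frame A i y (g y))).
Proof. exact: cont_G. Qed.

Let G_gt0 y a : dom A i y -> a != 0 -> 0 < G y a a.
Proof.
move=> dy a0; apply: ip_pos; apply: contra a0 => /eqP fa.
by rewrite -[a](frameK dy) fa linear0.
Qed.

Let nm y a : 'rV[R]_3 := (Num.sqrt (G y a a))^-1 *: a.

Let cont_nm x (f : X -> 'rV[R]_3) : dom A i x -> f x != 0 -> vcont x f ->
  vcont x (fun y => nm y (f y)).
Proof.
move=> dx f0 cf; apply: vcontZ => //.
apply: cvgV; first by rewrite sqrtr_eq0 -ltNge G_gt0.
by apply: (continuous_comp (cont_G dx cf cf)); exact: sqrt_continuous.
Qed.

(* The process is run on the coordinates of vectors in the chart [i].  The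
   coordinate vectors [e0], [e1], [e2] stay independent of their predecessors,
   so no division by zero occurs on the domain of the chart. *)
Let e0 : 'rV[R]_3 := delta_mx 0 0.
Let e1 : 'rV[R]_3 := delta_mx 0 1.
Let e2 : 'rV[R]_3 := delta_mx 0 2.
Let w0 y := nm y e0.
Let v1 y := e1 - G y e1 (w0 y) *: w0 y.
Let w1 y := nm y (v1 y).
Let v2 y := e2 - G y e2 (w0 y) *: w0 y - G y e2 (w1 y) *: w1 y.
(* The frame of the chart may be negatively oriented; the sign is locally
   constant by [pos_cont], so the corrected last vector is still continuous. *)
Let sg y : R :=
  if `[< pos A y [tuple frame A i y (delta_mx 0 k) | k < 3] >] then 1 else -1.
Let w2 y := sg y *: nm y (v2 y).

Let vcontB (W : vectType R) x (f g : X -> W) :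
  vcont x f -> vcont x g -> vcont x (fun y => f y - g y).
Proof.
move=> cf cg; apply: vcontD => //.
by apply: vcont_lin cg => a u v; rewrite opprD scalerN.
Qed.

Let e0_neq0 : e0 != 0.
Proof.
by apply/eqP => /rowP/(_ 0); rewrite !mxE /=; apply/eqP; rewrite oner_eq0.
Qed.

Let v1E y : (v1 y 0 1 = 1) * (v1 y 0 2 = 0).
Proof. by split; rewrite !mxE /= !mulr0 subr0. Qed.

Let v2E y : v2 y 0 2 = 1.
Proof. by rewrite !mxE /= !(mulr0, subr0). Qed.

Let v1_neq0 y : v1 y != 0.
Proof.
by apply/eqP => /rowP/(_ 1); rewrite v1E mxE; apply/eqP; rewrite oner_eq0.
Qed.

Let v2_neq0 y : v2 y != 0.
Proof.
by apply/eqP => /rowP/(_ 2); rewrite v2E mxE; apply/eqP; rewrite oner_eq0.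
Qed.

Let cont_w0 x : dom A i x -> vcont x w0.
Proof. by move=> dx; apply: cont_nm => //; exact: vcont_cst. Qed.

Let cont_w1 x : dom A i x -> vcont x w1.
Proof.
move=> dx; apply: cont_nm => //; apply: vcontB; first exact: vcont_cst.
by apply: vcontZ; [apply: cont_G => //; first exact: vcont_cst|]; exact: cont_w0.
Qed.

Let cont_w2 x : dom A i x -> vcont x w2.
Proof.
move=> dx; apply: vcontZ.
  apply/vcontR; apply: (@vcont_near _ _ _ _ (fun=> sg x)); last exact: vcont_cst.
  apply: filterS (pos_cont dx) => y hy; rewrite /sg.
  by rewrite (propext hy).
apply: cont_nm => //; apply: vcontB; first apply: vcontB.
- exact: vcont_cst.
- by apply: vcontZ; [apply: cont_G => //; first exact: vcont_cst|]; exact: cont_w0.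
- by apply: vcontZ; [apply: cont_G => //; first exact: vcont_cst|]; exact: cont_w1.
Qed.


Let GC y a b : G y a b = G y b a. Proof. exact: ip_sym. Qed.

Let GZr y c a b : G y a (c *: b) = c * G y a b.
Proof. by rewrite -!(lin_ofE ((bilin_G y).2 a)) linearZ. Qed.

Let GZl y c a b : G y (c *: a) b = c * G y a b.
Proof. by rewrite GC GZr GC. Qed.

Let GBr y a b c : G y a (b - c) = G y a b - G y a c.
Proof. by rewrite -!(lin_ofE ((bilin_G y).2 a)) linearB. Qed.

Section AtPoint.
Variables (y : X) (dy : dom A i y).

Let G_nm a : a != 0 -> G y (nm y a) (nm y a) = 1.
Proof.
move=> a0; rewrite GZr GZl mulrA -expr2 exprVn sqr_sqrtr ?ltW ?G_gt0 //.
by rewrite mulVf // gt_eqF ?G_gt0.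
Qed.

Let G00 : G y (w0 y) (w0 y) = 1. Proof. exact: G_nm. Qed.
Let G11 : G y (w1 y) (w1 y) = 1. Proof. exact: G_nm. Qed.
Let G22 : G y (w2 y) (w2 y) = 1.
Proof.
rewrite GZr GZl G_nm // mulr1 /sg; case: ifP => _; first exact: mulr1.
by rewrite mulrNN mulr1.
Qed.
Let G01 : G y (w0 y) (w1 y) = 0.
Proof.
have Gv1 : G y (w0 y) (v1 y) = 0.
  rewrite /v1 GBr (_ : G y (w0 y) (_ *: _) = G y e1 (w0 y) * G y (w0 y) (w0 y)).
    by rewrite G00 mulr1 GC subrr.
  exact: GZr.
by rewrite GZr Gv1 mulr0.
Qed.
Let Gv2 u : G y u (v2 y) =
  G y u e2 - G y e2 (w0 y) * G y u (w0 y) - G y e2 (w1 y) * G y u (w1 y).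
Proof. by rewrite /v2 2!GBr; congr (_ - _ - _); exact: GZr. Qed.
Let Gw2 u : G y u (w2 y) = sg y * ((Num.sqrt (G y (v2 y) (v2 y)))^-1 * G y u (v2 y)).
Proof. by rewrite GZr; congr (_ * _); exact: GZr. Qed.
Let G02 : G y (w0 y) (w2 y) = 0.
Proof. by rewrite Gw2 (Gv2 (w0 y)) G00 G01 mulr1 mulr0 subr0 GC subrr !mulr0. Qed.
Let G12 : G y (w1 y) (w2 y) = 0.
Proof.
by rewrite Gw2 (Gv2 (w1 y)) G11 (GC _ (w1 y) (w0 y)) G01 mulr1 mulr0 subr0 GC subrr !mulr0.
Qed.

Definition gram_schmidt k : 'rV[R]_3 :=
  if k == 0 :> 'I_3 then w0 y else if k == 1 then w1 y else w2 y.

Let ord3P (P : 'I_3 -> Prop) : P 0 -> P 1 -> P 2 -> forall k, P k.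
Proof.
move=> p0 p1 p2 [[|[|[|//]]] lt].
- by rewrite (_ : Ordinal lt = 0) //; apply/val_inj.
- by rewrite (_ : Ordinal lt = 1) //; apply/val_inj.
- by rewrite (_ : Ordinal lt = 2) //; apply/val_inj.
Qed.

Lemma gram_schmidt_orthonormal k l :
  ip A (frame A i y (gram_schmidt k)) (frame A i y (gram_schmidt l)) =
  (k == l)%:R.
Proof.
rewrite -/(G y _ _).
by move: k l; apply: ord3P; apply: ord3P; rewrite /gram_schmidt /=
  ?(G00, G11, G22, G01, G02, G12) // GC ?(G01, G02, G12).
Qed.

(** The matrix of the new basis in the frame of the chart is triangular, with a
  determinant of the sign [sg]. *)
Lemma gram_schmidt_pos : pos A y [tuple frame A i y (gram_schmidt k) | k < 3].
Proof.
have tI : injective (triv A i y) := can_inj (trivK dy).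
have dV : \dim {:fib A y} = 3.
  by have [e /pos_basis be] := pos_ex A y; rewrite (size_basis be).
set e := [tuple frame A i y (delta_mx 0 k) | k < 3]; set f := [tuple _ | _ < 3].
have te k : triv A i y (tnth e k) = delta_mx 0 k by rewrite tnth_mktuple frameK.
have be : basis_of {:fib A y} e.
  apply: (basis_mx tI dV); rewrite (_ : \matrix_(_, _) _ = 1%:M) ?det1 ?oner_eq0 //.
  by apply/matrixP => k l; rewrite !mxE te !mxE eqxx eq_sym.
pose a : R := (Num.sqrt (G y e0 e0))^-1.
pose b : R := (Num.sqrt (G y (v1 y) (v1 y)))^-1.
pose c : R := (Num.sqrt (G y (v2 y) (v2 y)))^-1.
have s_gt0 v : v != 0 -> 0 < (Num.sqrt (G y v v))^-1.
  by move=> v0; rewrite invr_gt0 sqrtr_gt0 G_gt0.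
have abc : 0 < a * b * c by rewrite !mulr_gt0 ?s_gt0.
pose W : 'M[R]_3 := \matrix_(k, l) triv A i y (tnth f k) 0 l.
have dW : \det W = a * b * c * sg y.
  have rW k : row k W = gram_schmidt k.
    by apply/rowP => l; rewrite !mxE tnth_mktuple frameK.
  have E0 : (w0 y 0 0 = a) * (w0 y 0 1 = 0) * (w0 y 0 2 = 0).
    by split; [split|]; rewrite !mxE /= ?mulr1 ?mulr0.
  have E1 : (w1 y 0 1 = b) * (w1 y 0 2 = 0).
    by split; rewrite [LHS]mxE v1E ?mulr1 ?mulr0.
  have E2 : w2 y 0 2 = sg y * c by rewrite [LHS]mxE [X in _ * X]mxE v2E mulr1.
  have f1 : (2 + 1 : 'I_3) = 0 by apply/val_inj.
  have f2 : (2 + 2 : 'I_3) = 1 by apply/val_inj.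
  have f3 : (1 + 1 : 'I_3) = 2 by apply/val_inj.
  have f4 : (0 + 1 : 'I_3) = 1 by apply/val_inj.
  have f5 : (0 + 2 : 'I_3) = 2 by apply/val_inj.
  have f6 : (1 + 2 : 'I_3) = 0 by apply/val_inj.
  rewrite det3E !rW /gram_schmidt [_ == _]/= [1 == 0]/= [2 == 0]/= [2 == 1]/= dot3E /cross3.
  rewrite ![(\row_k _) _ _]mxE f1 f2 f3 f4 f5 f6 !E0 !E1 !E2; ring.
have nW : \det W != 0.
  rewrite dW mulf_neq0 //; first by rewrite gt_eqF.
  by rewrite /sg; case: ifP => _; rewrite ?oppr_eq0 oner_eq0.
have bf : basis_of {:fib A y} f := basis_mx tI dV nW.
apply/(pos_iff be bf).
have -> : bmx e f = W.
  by apply/matrixP => k l; rewrite !mxE (coord_mx tI be te).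
rewrite dW pmulr_rgt0 // /sg; case: asboolP => pe; first by rewrite ltr01.
by rewrite oppr_gt0 ltr10; split.
Qed.

End AtPoint.

Lemma gram_schmidt_cont x k : dom A i x -> vcont x (gram_schmidt^~ k).
Proof.
move=> dx; rewrite /gram_schmidt; case: (k == 0); first exact: cont_w0.
by case: (k == 1); [exact: cont_w1 | exact: cont_w2].
Qed.

End LocalFrame.

(** * Continuous frames and local lifts to Spin(3) *)

Section SpinLift.
Context {R : realType} {V : vectType R}.

(** For a unit quaternion [q] this says that [q] lifts to Spin(3) the rotation
  from the coordinates [t'] to the coordinates [t]; the equation is linear in
  [q], so that intertwiners can be normalised after they are found. *)
Definition spin_lift (t t' : 'Hom(V, 'rV[R]_3)) (q : quat R) :=
  forall v, ((0, t v) : quat R) * q = q * ((0, t' v) : quat R).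

Lemma spin_lift_rid t t' q (b : R^o * V) : spin_lift t t' q ->
  (rid_lfun t b : quat R) * q = q * (rid_lfun t' b : quat R).
Proof.
move=> hq; case: b => s v; rewrite !rid_lfunE /=.
have E (u : 'rV[R]_3) : ((s, u) : quat R) = s *: 1 + ((0, u) : quat R).
  by congr pair => /=; rewrite ?scaler0 ?add0r ?addr0 // /GRing.scale /= mulr1.
by rewrite !E mulrDl mulrDr hq -scalerAl -scalerAr mul1r mulr1.
Qed.

Lemma spin_lift_comp t1 t2 t3 q r :
  spin_lift t1 t2 q -> spin_lift t2 t3 r -> spin_lift t1 t3 (q * r).
Proof. by move=> hq hr v; rewrite mulrA hq -mulrA hr mulrA. Qed.

End SpinLift.

Section CFrame.
Context {R : realType} {X : topologicalType} {A : oe3bundle R X}.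
Implicit Types (D : set X) (th : forall x, 'Hom(fib A x, 'rV[R]_3)).

(** An oriented isometric trivialisation of [A] over [D], compatible with the
  atlas of [A]. *)
Definition cont_oframe D th := forall x, D x ->
  oframe (th x) /\
  forall a, dom A a x -> hcont x (fun y => (th y \o frame A a y)%VF).

Let gsvec i x k := frame A i x (gram_schmidt i x k).

Lemma lin_coord_ip (x : X) (w : 'I_3 -> fib A x) :
  linear (fun v : fib A x => \row_k ip A v (w k)).
Proof. by move=> a u v; apply/rowP => k; rewrite !mxE ip_lin. Qed.

Definition gsframe i x : 'Hom(fib A x, 'rV[R]_3) := lin_of (lin_coord_ip (gsvec i x)).

Lemma gsframe_gsvec i x k : dom A i x -> gsframe i x (gsvec i x k) = delta_mx 0 k.
Proof.
move=> dx; apply/rowP => l.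
by rewrite lin_ofE !mxE gram_schmidt_orthonormal //= eq_sym.
Qed.

Lemma gsframe_oframe i x : dom A i x -> oframe (gsframe i x).
Proof.
move=> dx; have pe := gram_schmidt_pos dx; have be := pos_basis pe.
set e := [tuple _ | _ < 3] in pe be.
have eE k : tnth e k = gsvec i x k by rewrite tnth_mktuple.
split; last by exists e => // k; rewrite eE gsframe_gsvec.
move=> u v; have [Bl Br] := @bilin_ip _ _ A x.
have [bl br] := @bilin_dot3 R.
have ke (k : 'I_3) : e`_k = gsvec i x k by rewrite -eE (tnth_nth 0).
rewrite (coord_basis be (memvf u)) (coord_basis be (memvf v)).
rewrite !linear_sum (linear_sumE _ _ _ (Bl _)).
under eq_bigr do rewrite linearZ /=.
rewrite (linear_sumE _ _ _ (bl _)); apply: eq_bigr => k _; congr (_ *: _).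
rewrite (linear_sumE _ _ _ (Br _)).
under eq_bigr do rewrite linearZ /=.
rewrite (linear_sumE _ _ _ (br _)); apply: eq_bigr => l _; congr (_ *: _).
rewrite !ke !gsframe_gsvec // gram_schmidt_orthonormal // /dot3 trmx_delta mul_delta_mx_cond.
by rewrite mulmxnE mxE !eqxx.
Qed.

Lemma gsframe_cont_oframe i : cont_oframe (dom A i) (gsframe i).
Proof.
move=> x dx; split; first exact: gsframe_oframe.
move=> a da b; apply: vcont_row => k; apply/vcontR.
apply: (@vcont_near _ _ _ _ (fun y => ip A (frame A a y b)
  (frame A a y ((triv A a y \o frame A i y)%VF (gram_schmidt i y k))))).
  apply: filterS (near_dom da) => y dy.
  by rewrite comp_lfunE trivK // comp_lfunE lin_ofE mxE.
apply/vcontR; apply: ip_frame_cont => //; first exact: vcont_cst.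
by apply: vcont_lfun; [exact: trans_cont | exact: gram_schmidt_cont].
Qed.

(** The inverse of an isometry is its adjoint.  Expanding it in the Gram-Schmidt
  basis makes its continuity evident and avoids the inversion of a matrix of
  functions. *)
Lemma oframe_invE th i x u : dom A i x -> oframe (th x) ->
  (th x)^-1%VF u = \sum_k dot3 u (th x (gsvec i x k)) *: gsvec i x k.
Proof.
move=> dx hth; apply: (oframe_inj (gsframe_oframe dx)).
rewrite linear_sum [LHS]row_sum_delta; apply: eq_bigr => k _.
by rewrite linearZ /= gsframe_gsvec // lin_ofE mxE -hth.1 oframeVK.
Qed.

Lemma cont_oframe_inv D th a x : open D -> D x -> cont_oframe D th -> dom A a x ->
  hcont x (fun y => (triv A a y \o (th y)^-1)%VF).
Proof.
move=> oD Dx hth da u; have [i dx] := dom_cover A x.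
have cw k : vcont x (gram_schmidt i ^~ k) by exact: gram_schmidt_cont.
apply: (@vcont_near _ _ _ _ (fun y => \sum_k
    dot3 u ((th y \o frame A i y)%VF (gram_schmidt i y k)) *:
    (triv A a y \o frame A i y)%VF (gram_schmidt i y k))).
  apply: filterS2 (near_dom dx) (open_nbhs_nbhs (conj oD Dx)) => y dy Dy.
  rewrite comp_lfunE (oframe_invE _ dy (hth y Dy).1).
  rewrite linear_sum; apply: eq_bigr => k _.
  by rewrite linearZ /= !comp_lfunE.
apply: vcont_sum => k; apply: vcontZ.
  apply: (vcont_bilinR bilin_dot3); first exact: vcont_cst.
  by apply: vcont_lfun => //; exact: (hth x Dx).2.
by apply: vcont_lfun => //; exact: trans_cont.
Qed.

Lemma cont_oframe_trans D D' th th' x : open D -> open D' -> D x -> D' x ->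
  cont_oframe D th -> cont_oframe D' th' -> hcont x (fun y => (th y \o (th' y)^-1)%VF).
Proof.
move=> oD oD' Dx D'x hth hth'; have [a da] := dom_cover A x.
apply: (@hcont_near _ _ _ _ _ (fun y =>
  ((th y \o frame A a y) \o (triv A a y \o (th' y)^-1))%VF)).
  apply: filterS (near_dom da) => y dy; apply/lfunP => u.
  by rewrite !comp_lfunE trivK.
by apply: hcont_comp; [exact: (hth x Dx).2 | exact: cont_oframe_inv D'x hth' da].
Qed.

Lemma vcont_quat x (s : R) (f : X -> 'rV[R]_3) :
  vcont x f -> vcont x (fun y => (s, f y) : quat R).
Proof.
move=> cf; have -> : (fun y => (s, f y) : quat R) =
    fun y => (s, 0) + ((0, f y) : quat R).
  by apply/funext => y; congr pair => /=; rewrite ?addr0 ?add0r.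
apply: vcontD; first exact: vcont_cst.
apply: (@vcont_lin _ _ _ _ (fun v : 'rV[R]_3 => (0, v) : quat R)) cf => a u v.
by congr pair => /=; rewrite scaler0 addr0.
Qed.

(** Any two trivialisations differ by a rotation that lifts continuously near
  each point: the intertwiner of [averaging] is continuous, nonzero at [x] for
  a suitable basis quaternion, hence nonzero near [x] and can be normalised. *)
Lemma local_lift D D' th th' x : open D -> open D' -> D x -> D' x ->
  cont_oframe D th -> cont_oframe D' th' ->
  exists q : X -> quat R, \forall y \near x,
    [/\ vcont y q, qnorm2 (q y) = 1 &
        spin_lift (th y) (th' y) (q y)].
Proof.
move=> oD oD' Dx D'x hth hth'.
pose phi y (h : quat R) : quat R := rid_lfun (th y) (rid_lfun (th' y)^-1%VF h).
have lphi y : linear (phi y) by move=> a u v; rewrite /phi !linearP.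
have phi1 y : phi y 1 = 1 by rewrite /phi !rid_lfunE /= !linear0.
have phiM y (p q : quat R) : D y -> D' y -> phi y (p * q) = phi y p * phi y q.
  move=> Dy D'y; rewrite /phi -(rid_mul (hth y Dy).1); congr (rid_lfun _ _).
  apply: (can_inj (ridK (hth' y D'y).1)).
  by rewrite (rid_mul (hth' y D'y).1) !(ridVK (hth' y D'y).1).
have cphi y h : D y -> D' y -> vcont y (phi ^~ h).
  move=> Dy D'y; rewrite /phi; apply: (@vcont_near _ _ _ _
    (fun z => (h.1, (th z \o (th' z)^-1)%VF h.2))).
    by apply: nearW => z; rewrite !rid_lfunE /= comp_lfunE.
  by apply: vcont_quat; exact: cont_oframe_trans Dy D'y hth hth' h.2.
have [r Tr] := averaging_neq0 (phi1 x).
pose T y := averaging (phi y) (qb r).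
have cT y : D y -> D' y -> vcont y T.
  move=> Dy D'y; apply: vcont_sum => p; apply: vcont_mulq; last exact: vcont_cst.
  by apply: vcont_mulq; [exact: cphi | exact: vcont_cst].
exists (fun y => normalise (T y)).
apply: filterS3 (vcont_neq0 (cT x Dx D'x) Tr) (open_nbhs_nbhs (conj oD Dx))
  (open_nbhs_nbhs (conj oD' D'x)) => y T0 Dy D'y.
split; [exact: vcont_normalise (cT y Dy D'y) T0 | exact: qnorm2_normalise | move=> v].
rewrite /normalise -scalerAr -scalerAl; congr (_ *: _).
rewrite -(averagingP (lphi y) (fun p q => phiM y p q Dy D'y)).
by congr (_ * _); rewrite /phi !rid_lfunE /= (oframeK (hth' y D'y).1).
Qed.

End CFrame.

(** * Cech cohomology *)

Section Cech.
Context {X : topologicalType}.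
Implicit Types c : cech2 X.

Lemma lc_sub (T : Type) (D E : set X) (f : X -> T) :
  E `<=` D -> locally_constant D f -> locally_constant E f.
Proof. by move=> ED lf x /ED; exact: lf. Qed.

Lemma lcD (D : set X) (f g : X -> 'F_2) :
  locally_constant D f -> locally_constant D g ->
  locally_constant D (fun x => f x + g x).
Proof.
move=> lf lg x Dx; apply: filterS2 (lf x Dx) (lg x Dx) => y -> ->; exact: erefl.
Qed.

Lemma lcN (D : set X) (f : X -> 'F_2) :
  locally_constant D f -> locally_constant D (fun x => - f x).
Proof. by move=> lf x Dx; apply: filterS (lf x Dx) => y ->. Qed.

Lemma cohomologous_refl c : cohomologous c c.
Proof.
exists (cidx c), (cdom c), id, id, (fun _ _ _ => 0); split=> //.
- exact: cdom_open.
- exact: cdom_cover.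
- by move=> i j x _; apply: nearW.
- by move=> i j k x _ _ _; rewrite subrr subr0 addr0.
Qed.

Lemma cohomologous_sym c c' : cohomologous c c' -> cohomologous c' c.
Proof.
move=> [I [W [r [r' [b [oW cW sW lb hb]]]]]].
exists I, W, r', r, (fun i j x => - b i j x); split=> //.
- by move=> i x /sW [].
- by move=> i j; exact: lcN.
- by move=> i j k x Wi Wj Wk; rewrite -opprB hb // !opprD !opprK.
Qed.

(** Two refinement maps [u], [v] give cohomologous pullbacks.  The homotopy [h]
  is read off the two triangles that cut the square from [u i] to [v j]. *)
Lemma cech_refine c (I : Type) (u v : I -> cidx c) i j k x :
  cdom c (u i) x -> cdom c (u j) x -> cdom c (u k) x ->
  cdom c (v i) x -> cdom c (v j) x -> cdom c (v k) x ->
  let h i j := cval c (u i) (v i) (v j) x - cval c (u i) (u j) (v j) x in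
  cval c (v i) (v j) (v k) x - cval c (u i) (u j) (u k) x = h j k - h i k + h i j.
Proof.
move=> ui uj uk vi vj vk /=.
pose a p q t := cval c p q t x.
have e1 : a (u j) (u k) (v k) - a (u i) (u k) (v k) + a (u i) (u j) (v k)
  - a (u i) (u j) (u k) = 0 by exact: cval_cocycle.
have e2 : a (u j) (v j) (v k) - a (u i) (v j) (v k) + a (u i) (u j) (v k)
  - a (u i) (u j) (v j) = 0 by exact: cval_cocycle.
have e3 : a (v i) (v j) (v k) - a (u i) (v j) (v k) + a (u i) (v i) (v k)
  - a (u i) (v i) (v j) = 0 by exact: cval_cocycle.
rewrite -!/(a _ _ _); apply: subr0_eq.
transitivity (0 - 0 + 0 : 'F_2); last by rewrite subrr addr0.
by rewrite -{1}e3 -{1}e2 -{1}e1; ring.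
Qed.

(** Transitivity needs a common refinement of two refinements, on which the
  middle cocycle is seen through two different refinement maps. *)
Lemma cohomologous_trans c c' c'' :
  cohomologous c c' -> cohomologous c' c'' -> cohomologous c c''.
Proof.
move=> [I [W [r [r' [b [oW cW sW lb hb]]]]]].
move=> [J [V [s [s' [d [oV cV sV ld hd]]]]]].
pose u (p : I * J) := r' p.1; pose v (p : I * J) := s p.2.
pose h p q x := cval c' (u p) (v p) (v q) x - cval c' (u p) (u q) (v q) x.
exists (I * J)%type, (fun p => W p.1 `&` V p.2), (fun p => r p.1),
  (fun p => s' p.2), (fun p q x => b p.1 q.1 x + h p q x + d p.2 q.2 x).
split.
- by move=> p; apply: openI.
- by move=> x; have [i Wi] := cW x; have [j Vj] := cV x; exists (i, j).
- by move=> p x [/sW [cx _] /sV [_ c'x]].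
- move=> p q; apply: lcD; first apply: lcD.
  + by apply: lc_sub (lb p.1 q.1) => x [[? _] [? _]].
  + apply: lcD; last apply: lcN.
      apply: lc_sub (@cval_cst _ c' _ _ _) => x [[/sW [_ ?] /sV [? _]] [_ /sV [? _]]].
      by [].
    by apply: lc_sub (@cval_cst _ c' _ _ _) => x [[/sW [_ ?] _] [/sW [_ ?] /sV [? _]]].
  + by apply: lc_sub (ld p.2 q.2) => x [[_ ?] [_ ?]].
- move=> p q t x [Wp Vp] [Wq Vq] [Wt Vt].
  have := hb _ _ _ _ Wp Wq Wt; have := hd _ _ _ _ Vp Vq Vt.
  have := @cech_refine c' _ u v p q t x (sW _ _ Wp).2 (sW _ _ Wq).2 (sW _ _ Wt).2
    (sV _ _ Vp).1 (sV _ _ Vq).1 (sV _ _ Vt).1.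
  rewrite /= -!/(h _ _ x) => e1 e2 e3.
pose z1 := cval c' (v p) (v q) (v t) x; pose z2 := cval c' (u p) (u q) (u t) x.
set z3 := cval c'' _ _ _ x; set z4 := cval c _ _ _ x.
transitivity ((z3 - z1) + (z1 - z2) + (z2 - z4)); first by ring.
by rewrite e1 e2 e3; ring.
Qed.

End Cech.

(** * Signs and small covers *)

Section SignBit.
Context {R : realType}.

(** The logarithm [{1, -1} -> Z/2], extended to the nonzero reals. *)
Definition sgn2 (a : R) : 'F_2 := if 0 < a then 0 else 1.

Lemma sgn2M a b : a != 0 -> b != 0 -> sgn2 (a * b) = sgn2 a + sgn2 b.
Proof.
rewrite /sgn2 !neq_lt => /orP[a0|a0] /orP[b0|b0].
- by rewrite nmulr_rgt0 // b0 !ltNge !ltW //=; apply/val_inj.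
- by rewrite pmulr_lgt0 // b0 !ltNge !ltW //= addr0.
- by rewrite pmulr_rgt0 // a0 !ltNge !ltW //= add0r.
- by rewrite pmulr_rgt0 // a0 b0 addr0.
Qed.

Lemma sgn2K (a : R) : a ^+ 2 = 1 -> (-1) ^+ (sgn2 a) = a.
Proof.
move/eqP; rewrite sqrf_eq1 => /orP[]/eqP->; rewrite /sgn2 ?ltr01 ?expr0 //.
by rewrite oppr_gt0 ltr10 expr1.
Qed.

Lemma sgn2_sign (e : 'F_2) : sgn2 ((-1) ^+ e) = e.
Proof.
case: e => -[|[|//]] lt; rewrite /sgn2 /= ?expr0 ?ltr01 ?expr1.
  by apply/val_inj.
by rewrite oppr_gt0 ltr10; apply/val_inj.
Qed.

Lemma sgn2_near (X : topologicalType) (f : X -> R) x :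
  continuous_at x f -> f x != 0 -> \forall y \near x, sgn2 (f y) = sgn2 (f x).
Proof.
move=> cf; rewrite /sgn2 neq_lt => /orP[f0|f0].
  apply: filterS (cvgr_lt (f x) cf _ f0) => y fy.
  by rewrite !ltNge !ltW.
by apply: filterS (continuous_gt0 cf f0) => y ->; rewrite f0.
Qed.

End SignBit.

Section Finite.
Context {X : topologicalType}.

Lemma compact_finite_cover (N : X -> set X) : compact [set: X] ->
  (forall x, open (N x)) -> (forall x, N x x) ->
  exists D : seq X, forall x, exists2 d, d \in D & N d x.
Proof.
move=> cX oN Nx.
have [[x0 _]|X0] := pselect (exists x : X, True); last first.
  by exists [::] => x; case: X0; exists x.
(* the finite subcover property is available for pointed spaces *)
pose PX : ptopologicalType := HB.pack_for ptopologicalType X (isPointed.Build X x0).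
have : cover_compact [set: PX] by rewrite -compact_cover.
case/(_ X setT N) => [x _|x _|D _ DX]; first exact: oN.
  by exists x => //; exact: Nx.
by exists (finmap.enum_fset D) => x; have [d dD Ndx] := DX x I; exists d.
Qed.


(** The covers of Cech cohomology are indexed by types of a universe strictly
  below that of the points of [X], so that a cover by neighbourhoods of all
  points must be replaced by a small subcover. *)
Lemma small_cover (V : X -> set X) : compact [set: X] ->
  (forall x, open (V x)) -> (forall x, V x x) ->
  exists (I : Set) (u : I -> X), forall x, exists i, V (u i) x.
Proof.
move=> cX oV Vx.
have [[x0 _]|X0] := pselect (exists x : X, True); last first.
  by exists False, (fun v : False => match v return X with end) => x; case: X0; exists x.
have [D HD] := compact_finite_cover cX oV Vx.
exists nat, (nth x0 D) => x; have [d dD Vd] := HD x.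
by exists (index d D); rewrite nth_index.
Qed.

Lemma near_seq (F : set_system X) {FF : Filter F} (D : seq X)
    (P : X -> X -> Prop) :
  (forall d, d \in D -> \forall y \near F, P d y) ->
  \forall y \near F, forall d, d \in D -> P d y.
Proof.
elim: D => [|d D IHD] FP; first by apply: nearW.
have /IHD FD e : e \in D -> \forall y \near F, P e y.
  by move=> eD; apply: FP; rewrite inE eD orbT.
apply: filterS2 (FP d (mem_head _ _)) FD => y Pd PD e.
by rewrite inE => /orP[/eqP ->|/PD].
Qed.

End Finite.

(** * Existence of spin cocycles *)

Section SpinExists.
Context {R : realType} {X : topologicalType} (A : oe3bundle R X).

(** Spin(3) -> SO(3) has kernel {1, -1}: a quaternion commuting with all
  imaginary quaternions is real. *)
Lemma lift_unique x (t t' : 'Hom(fib A x, 'rV[R]_3)) (p q : quat R) :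
  oframe t' -> qnorm2 p = 1 -> qnorm2 q = 1 ->
  spin_lift t t' p -> spin_lift t t' q ->
  exists2 s : R, s ^+ 2 = 1 & p = s *: q.
Proof.
move=> ht' np nq1 hp hq; pose h : quat R := qconj q * p.
have hqc v : qconj q * ((0, t v) : quat R) = ((0, t' v) : quat R) * qconj q.
  exact: qconj_intertwine (hq v).
have hc (a : quat R) : a * h = h * a.
  have aE : a = a.1 *: 1 + ((0, a.2) : quat R).
    by case: a => a1 a2; congr pair => /=; rewrite ?scaler0 ?add0r ?addr0 //
      /GRing.scale /= mulr1.
  rewrite aE mulrDl mulrDr -scalerAl -scalerAr mul1r mulr1; congr (_ + _).
  have [v <-] := oframe_surj ht' a.2.
  by rewrite /h mulrA -hqc -mulrA hp mulrA.
have hE := center_real hc.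
have pE : p = qre h *: q.
  have : q * h = p by rewrite /h mulrA mulq_conj nq1 scale1r mul1r.
  by rewrite {1}hE -scalerAr mulr1.
exists (qre h) => //.
by have := np; rewrite pE qnorm2Z nq1 mulr1.
Qed.

(** The transition functions lift to Spin(3) near each point, but a cocycle needs
  one lift on each intersection of two members of the cover.  Let the [N d] be
  finitely many open sets that cover [X], whose closures lie in charts.  The
  neighbourhood [V x] of [x] is contained in one of them, [N (r x)], avoids
  those [N d] whose closure does not contain [x], and is so small that the
  transition from each of the other charts to that of [r x] lifts on it.  If
  [V x] meets [V z], then it meets [N (r z)], so the closure of [N (r z)]
  contains [x], and the lift chosen at [x] serves on the whole intersection. *)
Lemma spin_cocycle_exists : hausdorff_space X -> compact [set: X] ->
  exists c, spin_cocycle A c.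
Proof.
move=> hX cX.
have [i0 di0] := choice (dom_cover A).
have HN0 x : exists B : set X, [/\ open B, B x & closure B `<=` dom A (i0 x)].
  have reg : {for x, regular_space X}.
    by apply: (@compact_regular _ x setT) => //; exact: filterT.
  have [B nB cB] := reg _ (near_dom (di0 x)).
  exists (interior B); split; first exact: open_interior.
    exact: nB.
  by apply: subset_trans cB; apply: closure_subset; exact: interior_subset.
have [N HN] := choice HN0.
have oN x : open (N x) by have [] := HN x.
have Nx x : N x x by have [] := HN x.
have cN x : closure (N x) `<=` dom A (i0 x) by have [] := HN x.
have [D HD] := compact_finite_cover cX oN Nx.
have Hr0 x : exists d, d \in D /\ N d x by have [d] := HD x; exists d.
have [r Hr] := choice Hr0.
pose th d := @gsframe R X A (i0 d).
have cth d : cont_oframe (dom A (i0 d)) (th d) by exact: gsframe_cont_oframe.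
have oD d : open (dom A (i0 d)) by exact: dom_open.
pose good q x d y := [/\ vcont y q, qnorm2 (q y) = 1 & spin_lift (th (r x) y) (th d y) (q y)].
have subN x : N x `<=` dom A (i0 x) by apply: subset_trans (cN x); exact: subset_closure.
have HQ0 (x d : X) : exists q : X -> quat R,
    closure (N d) x -> \forall y \near x, good q x d y.
  have [dx|ndx] := pselect (closure (N d) x); last by exists (fun=> 0).
  have [q Hq] := local_lift (oD (r x)) (oD d) (subN _ _ (Hr x).2) (cN _ _ dx)
    (cth _) (cth d).
  by exists q.
have HQ1 x : exists Qx : X -> X -> quat R, forall d,
    closure (N d) x -> \forall y \near x, good (Qx d) x d y.
  by have [Qx] := choice (HQ0 x); exists Qx.
have [Q HQ] := choice HQ1.
pose V x := interior [set y | N (r x) y /\ forall d, d \in D ->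
  (closure (N d) x -> good (Q x d) x d y) /\ (N d y -> closure (N d) x)].
have Vsub x y : V x y -> N (r x) y by move=> /interior_subset [].
have Vgood x z y : V x y -> V z y -> good (Q x (r z)) x (r z) y.
  move=> /interior_subset [_ /(_ (r z) (Hr z).1) [g1 g2]] /Vsub Ny.
  by apply: g1; exact: g2.
have oV x : open (V x) by exact: open_interior.
have Vx x : V x x.
  apply: filterI; first by apply: open_nbhs_nbhs; split; [exact: oN|exact: (Hr x).2].
  apply: near_seq => d _.
  have [dx|ndx] := pselect (closure (N d) x).
    by apply: filterS (HQ x d dx) => y gy; split.
  have : nbhs x (~` closure (N d)).
    apply: open_nbhs_nbhs; split=> //; apply: closed_openC; exact: closed_closure.
  by apply: filterS => y ny; split=> // Ny; case: ny; exact: subset_closure.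
have ofr x y : V x y -> oframe (th (r x) y).
  by move=> /Vsub/subN/cth [].
pose q x z := Q x (r z).
(* the defect of the cocycle condition: a real number by [lift_unique], so that
   its real part, which is visibly continuous, is all of it *)
pose s i j k y : R := qre (q i j y * q j k y * qconj (q i k y)).
have sP i j k y : V i y -> V j y -> V k y ->
    s i j k y ^+ 2 = 1 /\ q i j y * q j k y = s i j k y *: q i k y.
  move=> Vi Vj Vk.
  have [_ n1 h1] := Vgood i j y Vi Vj; have [_ n2 h2] := Vgood j k y Vj Vk.
  have [_ n3 h3] := Vgood i k y Vi Vk.
  have n12 : qnorm2 (q i j y * q j k y) = 1 by rewrite qnorm2M n1 n2 mulr1.
  have h12 : spin_lift (th (r i) y) (th (r k) y) (q i j y * q j k y).
    exact: spin_lift_comp h1 h2.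
  have [e e1 eE] := lift_unique (ofr k y Vk) n12 n3 h12 h3.
  have -> : s i j k y = e.
    by rewrite /s eE -scalerAl mulq_conj n3 scale1r qE qoneE mulr1.
  by [].
have s0 i j k y : V i y -> V j y -> V k y -> s i j k y != 0.
  by move=> Vi Vj Vk; have [+ _] := sP i j k y Vi Vj Vk;
    apply: contra_eq_neq => ->; rewrite expr0n /= eq_sym oner_eq0.
pose c : X -> X -> X -> X -> 'F_2 := fun i j k y => sgn2 (s i j k y).
have lc i j k : locally_constant (V i `&` V j `&` V k) (c i j k).
  move=> y [[Vi Vj] Vk]; apply: sgn2_near; last exact: s0.
  have [c1 _ _] := Vgood i j y Vi Vj; have [c2 _ _] := Vgood j k y Vj Vk.
  have [c3 _ _] := Vgood i k y Vi Vk.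
  by apply: vcont_qre; apply: vcont_mulq; [exact: vcont_mulq|exact: vcont_qconj].
have cc i j k l y : V i y -> V j y -> V k y -> V l y ->
    c j k l y - c i k l y + c i j l y - c i j k y = 0.
  move=> Vi Vj Vk Vl.
  have : s j k l y * s i j l y = s i j k y * s i k l y.
    have [_ e1] := sP _ _ _ _ Vj Vk Vl; have [_ e2] := sP _ _ _ _ Vi Vj Vl.
    have [_ e3] := sP _ _ _ _ Vi Vj Vk; have [_ e4] := sP _ _ _ _ Vi Vk Vl.
    have [_ n1 _] := Vgood i l y Vi Vl.
    have := mulrA (q i j y) (q j k y) (q k l y).
    rewrite e1 e3 -scalerAr -scalerAl e2 e4 !scalerA.
    move=> e; have : qre ((s j k l y * s i j l y) *: q i l y * qconj (q i l y)) =
        qre ((s i j k y * s i k l y) *: q i l y * qconj (q i l y)) by rewrite e.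
    by rewrite -!scalerAl mulq_conj n1 scale1r !qE !mulr1.
  move/(congr1 sgn2); rewrite !sgn2M ?s0 // -!/(c _ _ _ _) => e.
  transitivity ((c j k l y + c i j l y) - (c i j k y + c i k l y)); first by ring.
  by rewrite e subrr.
have [I [u Vu]] := small_cover cX oV Vx.
exists (@Cech2 X I (fun i => V (u i)) (fun i j k => c (u i) (u j) (u k))
  (fun i => oV _) Vu (fun i j k => lc _ _ _) (fun i j k l => cc _ _ _ _)).
exists (fun i => th (r (u i))), (fun i j => q (u i) (u j)); split=> /=.
- by move=> i a x /Vsub/subN Di da; exact: (cth _ _ Di).2.
- by move=> i x /ofr.
- by move=> i j x Vi Vj; have [] := Vgood (u i) (u j) x Vi Vj.
- move=> i j k x Vi Vj Vk; have [s1 e] := sP _ _ _ _ Vi Vj Vk.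
  by rewrite /c sgn2K.
Qed.

End SpinExists.

(** * Bimodules over two quaternion fibres *)

Section Fibre.
Context {R : realType} {X : topologicalType} {A : oe3bundle R X} {x : X}.

Definition qcoord (t : 'Hom(fib A x, 'rV[R]_3)) : quat R -> R^o * fib A x :=
  rid_lfun (t^-1)%VF.

Lemma qcoord_linear t : linear (qcoord t).
Proof. by move=> a u v; rewrite /qcoord linearP. Qed.

Section Frame.
Variables (t : 'Hom(fib A x, 'rV[R]_3)) (ht : oframe t).

Lemma qcoord1 : qcoord t 1 = (1, 0).
Proof. by rewrite /qcoord rid_lfunE /= linear0. Qed.

Lemma qcoordM p q : qcoord t (p * q) =
  qmul (@ip R X A x) (@cross R X A x) (qcoord t p) (qcoord t q).
Proof.
apply: (can_inj (ridK ht)); rewrite (rid_mul ht) /qcoord.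
by rewrite !(ridVK ht).
Qed.

Lemma qcoordK : cancel (qcoord t) (rid_lfun t : _ -> quat R).
Proof. exact: ridVK ht. Qed.

Lemma bilin_qmul : bilin (qmul (@ip R X A x) (@cross R X A x)).
Proof.
split=> [w|v] a u1 u2; apply: (can_inj (ridK ht)).
  by rewrite [RHS]linearP /= !(rid_mul ht) linearP /= mulrDl -scalerAl.
by rewrite [RHS]linearP /= !(rid_mul ht) linearP /= mulrDr -scalerAr.
Qed.

Variables (t' : 'Hom(fib A x, 'rV[R]_3)) (ht' : oframe t').

Lemma qcoord_change (q : quat R) a : qnorm2 q = 1 ->
  spin_lift t t' q ->
  qcoord t' a = qcoord t (q * a * qconj q).
Proof.
move=> nq1 hq; apply: (can_inj (ridK ht)); rewrite [RHS]qcoordK.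
set b := qcoord t' a; have -> : a = rid_lfun t' b by rewrite /b (ridVK ht').
by rewrite -(spin_lift_rid _ hq) -mulrA mulq_conj nq1 scale1r mulr1.
Qed.

End Frame.
End Fibre.

Section Rho.
Context {R : realType} {X : topologicalType} {A B : oe3bundle R X}.
Context {M : vbundle X 'rV[R]_4}.
Let T := tensor_alg (quat_alg A) (opp_alg (quat_alg B)).
Variable Psi : forall x, 'Hom(fib T x, fib (end_alg M) x).
Hypotheses (cPsi : bundle_map_cont Psi) (bPsi : forall x, bijective (Psi x))
  (Psi1 : forall x, Psi x (aone T x) = aone (end_alg M) x)
  (PsiM : forall x a b, Psi x (amul T x a b) =
    amul (end_alg M) x (Psi x a) (Psi x b)).

Section Point.
Variable x : X.

(** [rho t t' a b m] is the product [a m b] in the bimodule structure that [Psi]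
  puts on the fibre of [M], the quaternions acting through the frames. *)
Definition rho (t : 'Hom(fib A x, 'rV[R]_3)) (t' : 'Hom(fib B x, 'rV[R]_3))
    (a b : quat R) : 'End(fib M x) :=
  Psi x (tens (qcoord t a) (qcoord t' b) : fib T x).

Lemma bilin_rho t t' : bilin (rho t t').
Proof.
have [tl tr] := @bilin_tens R (R^o * fib A x)%type (R^o * fib B x)%type.
split=> [b|a] s u v; rewrite /rho qcoord_linear ?tl ?tr; exact: linearP.
Qed.

Section Frames.
Variables (t : 'Hom(fib A x, 'rV[R]_3)) (t' : 'Hom(fib B x, 'rV[R]_3)).
Hypotheses (ht : oframe t) (ht' : oframe t').

Lemma rho1 m : rho t t' 1 1 m = m.
Proof.
have := Psi1 x; rewrite /rho !qcoord1 => ->.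
exact: id_lfunE.
Qed.

Lemma rhoM a b a' b' m : rho t t' (a * a') (b' * b) m = rho t t' a b (rho t t' a' b' m).
Proof.
have [Bl Br] := bilin_qmul ht'.
have E : tens (qcoord t (a * a')) (qcoord t' (b' * b)) =
    amul T x (tens (qcoord t a) (qcoord t' b)) (tens (qcoord t a') (qcoord t' b')).
  rewrite (qcoordM ht) (qcoordM ht').
  by rewrite [RHS](tensor_mul_tens _ _ _ _ (bilin_qmul ht) (conj Br Bl)).
by rewrite /rho E PsiM /= comp_lfunE.
Qed.

Lemma rhoZl s a b m : rho t t' (s *: a) b m = s *: rho t t' a b m.
Proof.
have := (bilin_rho t t').1 b; move=> lr.
by rewrite -!(lin_ofE lr) linearZ /= scale_lfunE.
Qed.

Lemma rhoZr s a b m : rho t t' a (s *: b) m = s *: rho t t' a b m.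
Proof.
have := (bilin_rho t t').2 a; move=> lr.
by rewrite -!(lin_ofE lr) linearZ /= scale_lfunE.
Qed.

(** A nonzero such [m] gives an isomorphism of bimodules [a |-> a m] from the
  quaternions to the fibre. *)
Definition central (m : fib M x) := forall a, rho t t' a 1 m = rho t t' 1 a m.

Definition casimir_op : 'End(fib M x) := \sum_p rho t t' (qb p) (qconj (qb p)).

Lemma casimir_central m : central (casimir_op m).
Proof.
move=> h; rewrite /casimir_op sum_lfunE !linear_sum.
have bB : bilin (fun a b => rho t t' a b m).
  have [Bl Br] := bilin_rho t t'.
  by split=> [b|a] s u v; rewrite ?Bl ?Br add_lfunE scale_lfunE.
transitivity (\sum_p rho t t' (h * qb p) (qconj (qb p)) m).
  by apply: eq_bigr => p _; rewrite /= -rhoM mulr1.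
rewrite (casimir h bB); apply: eq_bigr => p _.
by rewrite /= -rhoM mul1r.
Qed.

(** The Casimir element is not zero, as multiplication sends it to 4, and [Psi]
  is injective. *)
Lemma casimir_op_neq0 : casimir_op != 0.
Proof.
apply/eqP => C0.
have [lT rT] := @bilin_tens R (R^o * fib A x)%type (R^o * fib B x)%type.
pose F (u : R^o * fib A x) (v : R^o * fib B x) : R^o :=
  qre ((rid_lfun t u : quat R) * (rid_lfun t' v : quat R)).
have bF : bilin F.
  split=> [w|w] s u v; rewrite /F linearP /=.
    by rewrite mulrDl -scalerAl qaddE qscaleE.
  by rewrite mulrDr -scalerAr qaddE qscaleE.
have S0 : \sum_p (tens (qcoord t (qb p)) (qcoord t' (qconj (qb p))) : fib T x) = 0.
  apply: (bij_inj (bPsi x)); rewrite linear_sum linear0; exact: C0.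
have : lin_of (tlift_linear F)
    (\sum_p tens (qcoord t (qb p)) (qcoord t' (qconj (qb p)))) = 4 :> R.
  rewrite linear_sum /=; under eq_bigr do rewrite lin_ofE tliftE // /F !qcoordK //.
  by rewrite sum4 !qbE !(qconjE, qE); ring.
rewrite [X in lin_of _ X]S0 linear0 => /eqP; rewrite eq_sym pnatr_eq0 //.
Qed.


Lemma dim_quat : \dim {:quat R} = 4.
Proof. by rewrite dimvf. Qed.

Lemma dim_fib : \dim {:fib M x} = 4.
Proof.
have [i di] := dom_cover M x.
have kt : lker (triv M i x) == 0%VS by apply/lker0P/(can_inj (trivK di)).
have kf : lker (frame M i x) == 0%VS by apply/lker0P/(can_inj (frameK di)).
have d4 : \dim {:'rV[R]_4} = 4 by rewrite dimvf.
apply/eqP; rewrite eqn_leq; apply/andP; split.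
  rewrite -d4 -(limg_dim_eq (f := triv M i x) (U := fullv)) ?dimvS ?subvf //.
  by rewrite (eqP kt) capv0.
rewrite -d4 -(limg_dim_eq (f := frame M i x) (U := fullv)) ?dimvS ?subvf //.
by rewrite (eqP kf) capv0.
Qed.

(** A form of Schur's lemma.  By dimension the fibre is free of rank one over
  the quaternions, with generator [m]; the factor of [m'] commutes with all
  quaternions because both vectors are central. *)
Lemma central_line m m' : central m -> central m' -> m != 0 ->
  exists s : R, m' = s *: m.
Proof.
move=> cm cm' m0.
have lL : linear (fun h : quat R => rho t t' h 1 m).
  by move=> s u v; have [Bl _] := bilin_rho t t'; rewrite Bl add_lfunE scale_lfunE.
pose L := lin_of lL.
have LI h : L h = 0 -> h = 0.
  rewrite lin_ofE => Lh.
  have : rho t t' (qconj h * h) (1 * 1) m = 0 by rewrite rhoM Lh linear0.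
  rewrite mul1r mulq_conjl rhoZl rho1 => /eqP.
  by rewrite scaler_eq0 (negPf m0) orbF qnorm2_eq0 => /eqP.
have kL : lker L == 0%VS by apply/lker0P => u v e; apply/eqP; rewrite -subr_eq0;
  apply/eqP/LI; rewrite linearB /= e subrr.
have : m' \in limg L.
  suff /eqP -> : limg L == fullv by exact: memvf.
  rewrite eqEdim subvf (limg_dim_eq (f := L)) ?dim_fib ?dim_quat //.
  by rewrite (eqP kL) capv0.
case/memv_imgP => h _; rewrite lin_ofE => hm.
have hc (a : quat R) : a * h = h * a.
  apply/eqP; rewrite -subr_eq0; apply/eqP/LI; rewrite linearB /= !lin_ofE.
  rewrite -[X in rho t t' (a * h) X]mulr1 -[X in rho t t' (h * a) X]mulr1 !rhoM.
  by rewrite -hm cm' cm hm -!rhoM !mulr1 !mul1r subrr.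
exists (qre h); rewrite hm {1}(center_real hc) rhoZl rho1 //.
Qed.

End Frames.

Section Change.
Variables (t1 t2 : 'Hom(fib A x, 'rV[R]_3)) (t1' t2' : 'Hom(fib B x, 'rV[R]_3)).
Hypotheses (h1 : oframe t1) (h2 : oframe t2) (h1' : oframe t1') (h2' : oframe t2').
Variables (p q : quat R).
Hypotheses (np : qnorm2 p = 1) (nq1 : qnorm2 q = 1).
Hypothesis hp : spin_lift t1 t2 p.
Hypothesis hq : spin_lift t1' t2' q.

Lemma rho_change a b m :
  rho t2 t2' a b m = rho t1 t1' (p * a * qconj p) (q * b * qconj q) m.
Proof.
by rewrite /rho -(qcoord_change h1 h2 _ np hp) -(qcoord_change h1' h2' _ nq1 hq).
Qed.

(** Passing from the frames [t2], [t2'] to [t1], [t1'] conjugates the two actions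
  by [p] and [q]; multiplying [m] by [conj p] and [q] undoes this. *)
Lemma central_change m : central t2 t2' m ->
  central t1 t1' (rho t1 t1' (qconj p) q m).
Proof.
move=> cm a.
have pp : qconj p * p = 1 by rewrite mulq_conjl np scale1r.
have qq : qconj q * q = 1 by rewrite mulq_conjl nq1 scale1r.
have pp' : p * qconj p = 1 by rewrite mulq_conj np scale1r.
have qq' : q * qconj q = 1 by rewrite mulq_conj nq1 scale1r.
have := cm a; rewrite !rho_change !mulr1 pp' qq' => e.
rewrite -!rhoM // mulr1 mul1r.
have -> : a * qconj p = qconj p * (p * a * qconj p) by rewrite !mulrA pp mul1r.
have -> : q * a = (q * a * qconj q) * q by rewrite -!mulrA qq mulr1.
by rewrite -[in LHS](mul1r q) rhoM // e -rhoM // mulr1.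
Qed.

Lemma rho_change_neq0 m : m != 0 -> rho t1 t1' (qconj p) q m != 0.
Proof.
apply: contra_neq => e.
have : rho t1 t1' (p * qconj p) (q * qconj q) m = 0 by rewrite rhoM // e linear0.
by rewrite !mulq_conj np nq1 !scale1r rho1.
Qed.

Lemma rho_change_comp p' q' m :
  rho t1 t1' (qconj p) q (rho t2 t2' (qconj p') q' m) =
  rho t1 t1' (qconj (p * p')) (q * q') m.
Proof.
rewrite rho_change -rhoM //; congr (rho _ _ _ _ m).
  by rewrite qconjM !mulrA mulq_conjl np scale1r mul1r.
by rewrite -!mulrA mulq_conjl nq1 scale1r mulr1.
Qed.

End Change.
End Point.
End Rho.

(** * Morita equivalence makes the cocycles cohomologous *)

Section Forward.
Context {R : realType} {X : topologicalType} {A B : oe3bundle R X}.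
Context {M : vbundle X 'rV[R]_4}.
Let T := tensor_alg (quat_alg A) (opp_alg (quat_alg B)).
Variable Psi : forall x, 'Hom(fib T x, fib (end_alg M) x).
Hypotheses (cPsi : bundle_map_cont Psi) (bPsi : forall x, bijective (Psi x))
  (Psi1 : forall x, Psi x (aone T x) = aone (end_alg M) x)
  (PsiM : forall x a b, Psi x (amul T x a b) =
    amul (end_alg M) x (Psi x a) (Psi x b)).

Lemma qcoord_cont (C : oe3bundle R X) D th a x (f : X -> quat R) :
  open D -> D x -> @cont_oframe R X C D th -> dom C a x -> vcont x f ->
  vcont x (fun y => triv (quat_alg C) a y (qcoord (th y) (f y)) : quat R).
Proof.
move=> oD Dx hth da cf.
have cT : hcont x (fun y => (triv C a y \o (th y)^-1)%VF) by exact: cont_oframe_inv Dx hth da.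
have lsnd : linear (fun p : quat R => p.2 : 'rV[R]_3) by [].
have lfst : linear (fun p : quat R => (p.1, 0) : quat R).
  by move=> s u v; congr pair => /=; rewrite scaler0 addr0.
have -> : (fun y => triv (quat_alg C) a y (qcoord (th y) (f y)) : quat R) =
    fun y => ((f y).1, 0) + ((0, (triv C a y \o (th y)^-1)%VF (f y).2) : quat R).
  apply/funext => y; rewrite /= /qcoord !rid_lfunE /= comp_lfunE.
  by congr pair => /=; rewrite ?addr0 ?add0r.
apply: vcontD; first exact: (vcont_lin lfst).
by apply: vcont_quat; apply: vcont_lfun => //; exact: (vcont_lin lsnd).
Qed.

Lemma tens_cont (V W : vectType R) x (f : X -> V) (g : X -> W) :
  vcont x f -> vcont x g -> vcont x (fun y => tens (f y) (g y)).
Proof. exact: vcont_bilin (@bilin_tens _ _ _). Qed.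

Lemma frame_trivK (C : oe3bundle R X) a y v : dom C a y ->
  rid_lfun (frame C a y) (triv (quat_alg C) a y v) = v.
Proof. by move=> da; case: v => s v; rewrite /= !rid_lfunE /= trivK. Qed.

(** All frames and quaternions are transported to the charts of the atlases, in
  which [cPsi] applies. *)
Lemma rho_cont DA thA DB thB x (f g : X -> quat R) (u : X -> 'rV[R]_4) k l :
  open DA -> DA x -> @cont_oframe R X A DA thA ->
  open DB -> DB x -> @cont_oframe R X B DB thB ->
  vcont x f -> vcont x g -> vcont x u -> dom M k x -> dom M l x ->
  vcont x (fun y => triv M l y
    (rho Psi (thA y) (thB y) (f y) (g y) (frame M k y (u y)))).
Proof.
move=> oA Ax hA oB Bx hB cf cg cu dk dl.
have [a da] := dom_cover A x; have [b db] := dom_cover B x.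
pose tt y : tensor (quat R) (quat R) :=
  tens (triv (quat_alg A) a y (qcoord (thA y) (f y)) : quat R)
       (triv (quat_alg B) b y (qcoord (thB y) (g y)) : quat R).
have ctt : vcont x tt by apply: tens_cont;
  [exact: qcoord_cont oA Ax hA da cf | exact: qcoord_cont oB Bx hB db cg].
have cE := vcont_lfun (cPsi (i := (a, b)) (j := l) (conj da db) dl) ctt.
have bev : bilin (fun (h : 'End('rV[R]_4)) v => h v).
  by split=> [v|h] s u1 u2; rewrite ?add_lfunE ?scale_lfunE ?linearP.
have cv : vcont x (fun y => (triv M l y \o frame M k y)%VF (u y)).
  by apply: vcont_lfun => //; exact: trans_cont.
apply: vcont_near (vcont_bilin bev cE cv).
apply: filterS3 (near_dom da) (near_dom db) (near_dom dl) => y ya yb yl.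
rewrite !comp_lfunE /= lconjE !comp_lfunE. rewrite trivK //. congr (triv M l y _).
congr (fun_of_lfun (_ : 'End(fib M y)) _); rewrite /rho; congr (Psi y _).
by rewrite tmap_tens /= !frame_trivK.
Qed.

(** The Casimir element applied to a vector that is constant in a chart of [M]
  gives central vectors near [x], nonzero for a suitable vector. *)
Lemma local_central DA thA DB thB x :
  open DA -> DA x -> @cont_oframe R X A DA thA ->
  open DB -> DB x -> @cont_oframe R X B DB thB ->
  exists (W : set X) (m : forall y, fib M y),
    [/\ open W, W x, W `<=` DA `&` DB,
      forall y, W y -> m y != 0 /\ central Psi (thA y) (thB y) (m y) &
      forall y l, W y -> dom M l y -> vcont y (fun z => triv M l z (m z))].
Proof.
move=> oA Ax hA oB Bx hB.
have [k dk] := dom_cover M x.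
have [w Cw] : exists w, casimir_op Psi (thA x) (thB x) w != 0.
  apply: contrapT => C0.
  have := casimir_op_neq0 bPsi (hA x Ax).1 (hB x Bx).1; case/eqP.
  apply/lfunP => w; rewrite lfunE; apply/eqP/negPn/negP => Cw.
  by apply: C0; exists w.
pose v := triv M k x w.
pose m y := casimir_op Psi (thA y) (thB y) (frame M k y v).
have cm y l : DA y -> DB y -> dom M k y -> dom M l y ->
    vcont y (fun z => triv M l z (m z)).
  move=> Ay By ky ly.
  have -> : (fun z => triv M l z (m z)) = fun z => \sum_p triv M l z
      (rho Psi (thA z) (thB z) (qb p) (qconj (qb p)) (frame M k z v)).
    by apply/funext => z; rewrite /m /casimir_op sum_lfunE linear_sum.
  apply: vcont_sum => p.
  by apply: (rho_cont oA Ay hA oB By hB) => //; exact: vcont_cst.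
pose W := interior [set y | [/\ DA y, DB y, dom M k y & triv M k y (m y) != 0]].
have sW y : W y -> [/\ DA y, DB y, dom M k y & triv M k y (m y) != 0].
  by move/interior_subset.
exists W, m; split.
- exact: open_interior.
- have n0 : \forall y \near x, triv M k y (m y) != 0.
    apply: (vcont_neq0 (cm x k Ax Bx dk dk)); rewrite /m /v trivK //.
    by apply: contra_neq Cw => /(congr1 (frame M k x)); rewrite trivK // linear0.
  have nAB : nbhs x (DA `&` DB).
    by apply: filterI; apply: open_nbhs_nbhs.
  by apply: filterS3 nAB (near_dom dk) n0 => y [].
- by move=> y /sW [].
- move=> y /sW [Ay By ky mn]; split.
    by apply: contra_neq mn => ->; rewrite linear0.
  exact: (casimir_central PsiM (hA y Ay).1 (hB y By).1).
- by move=> y l /sW [Ay By ky _]; exact: cm.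
Qed.

Lemma dot4_gt0 (u : 'rV[R]_4) : u != 0 -> 0 < (u *m u^T) 0 0.
Proof.
move=> u0; rewrite mxE lt_neqAle eq_sym sumr_ge0 ?andbT => [|k _]; last first.
  by rewrite mxE -expr2 sqr_ge0.
apply: contra u0 => /eqP S0; apply/eqP/rowP => k; rewrite mxE.
have u_ge0 (j : 'I_4) : true -> 0 <= u 0 j * u^T j 0.
  by rewrite mxE -expr2 sqr_ge0.
have := psumr_eq0P u_ge0 S0 (i := k) isT.
by rewrite mxE -expr2 => /eqP; rewrite sqrf_eq0 => /eqP.
Qed.

Lemma spin_cont_oframe (C : oe3bundle R X) (c : cech2 X) th :
  (forall i a x, cdom c i x -> dom C a x ->
        hcont x (fun y => (th i y \o frame C a y)%VF)) ->
  (forall i x, cdom c i x ->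
        (forall u v, dot3 (th i x u) (th i x v) = ip C u v) /\
        (exists2 e, pos C x e & forall k, th i x (tnth e k) = delta_mx 0 k)) ->
  forall i, @cont_oframe R X C (cdom c i) (th i).
Proof. by move=> h1 h2 i x Dx; split; [exact: h2 | move=> a; exact: h1]. Qed.

Lemma char2 (e : 'F_2) : e + e = 0.
Proof. by case: e => -[|[|//]] lt; apply/val_inj. Qed.

(** Local generators [m i] of the line of central vectors are compared on
  overlaps: the lifts [p i j], [q i j] carry [m j] to a multiple [lam i j] of
  [m i].  The composition of two comparisons differs from the third by the signs
  of the two cocycles, so the signs of the [lam i j] form a cochain whose
  coboundary is the difference of the cocycles. *)
Lemma morita_cohomologous (c d : cech2 X) : compact [set: X] ->
  spin_cocycle A c -> spin_cocycle B d -> cohomologous c d.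
Proof.
move=> cX [tA [p [hA1 hA2 hp Hp]]] [tB [q [hB1 hB2 hq Hq]]].
have fA := spin_cont_oframe hA1 hA2; have fB := spin_cont_oframe hB1 hB2.
have oA := @cdom_open _ c; have oB := @cdom_open _ d.
have [iA diA] := choice (@cdom_cover _ c); have [iB diB] := choice (@cdom_cover _ d).
have HW0 x : exists Wm : set X * (forall y, fib M y),
    [/\ open Wm.1, Wm.1 x, Wm.1 `<=` cdom c (iA x) `&` cdom d (iB x),
      forall y, Wm.1 y -> Wm.2 y != 0 /\
        central Psi (tA (iA x) y) (tB (iB x) y) (Wm.2 y) &
      forall y l, Wm.1 y -> dom M l y -> vcont y (fun z => triv M l z (Wm.2 z))].
  have [W [m H]] := local_central (oA _) (diA x) (fA _) (oB _) (diB x) (fB _).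
  by exists (W, m).
have [Wm HW] := choice HW0.
have oWm x : open (Wm x).1 by have [] := HW x.
have Wmx x : (Wm x).1 x by have [] := HW x.
have [I [u Wu]] := small_cover cX oWm Wmx.
pose W i := (Wm (u i)).1; pose m i := (Wm (u i)).2.
pose r i := iA (u i); pose r' i := iB (u i).
have oW i : open (W i) by have [] := HW (u i).
have sW i y : W i y -> cdom c (r i) y /\ cdom d (r' i) y.
  by have [_ _ h _ _] := HW (u i); move/h.
have mP i y : W i y -> m i y != 0 /\ central Psi (tA (r i) y) (tB (r' i) y) (m i y).
  by have [_ _ _ h _] := HW (u i); exact: h.
have mc i y l : W i y -> dom M l y -> vcont y (fun z => triv M l z (m i z)).
  by have [_ _ _ _ h] := HW (u i); exact: h.
have oFA i y : W i y -> oframe (tA (r i) y) by move=> /sW [/fA []].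
have oFB i y : W i y -> oframe (tB (r' i) y) by move=> /sW [_ /fB []].
pose tr i j y := rho Psi (tA (r i) y) (tB (r' i) y)
  (qconj (p (r i) (r j) y)) (q (r' i) (r' j) y) (m j y).
pose lam i j y : R := xget 0 [set s | tr i j y = s *: m i y].
have pP i j y : W i y -> W j y -> [/\ vcont y (p (r i) (r j)),
    qnorm2 (p (r i) (r j) y) = 1 & spin_lift (tA (r i) y) (tA (r j) y) (p (r i) (r j) y)].
  by move=> /sW [ci _] /sW [cj _]; exact: hp.
have qP i j y : W i y -> W j y -> [/\ vcont y (q (r' i) (r' j)),
    qnorm2 (q (r' i) (r' j) y) = 1 &
    spin_lift (tB (r' i) y) (tB (r' j) y) (q (r' i) (r' j) y)].
  by move=> /sW [_ ci] /sW [_ cj]; exact: hq.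
have lamP i j y : W i y -> W j y -> tr i j y = lam i j y *: m i y /\ lam i j y != 0.
  move=> Wi Wj; have [_ np hpi] := pP i j y Wi Wj; have [_ n1 hqi] := qP i j y Wi Wj.
  have [mi0 ci] := mP i y Wi; have [mj0 cj] := mP j y Wj.
  have ct : central Psi (tA (r i) y) (tB (r' i) y) (tr i j y).
    exact: (central_change PsiM (oFA i y Wi) (oFA j y Wj) (oFB i y Wi) (oFB j y Wj)
      np n1 hpi hqi cj).
  have t0 : tr i j y != 0.
    exact: (rho_change_neq0 Psi1 PsiM (oFA i y Wi) (oFB i y Wi) np n1 mj0).
  have [s hs] := central_line Psi1 PsiM (oFA i y Wi) (oFB i y Wi) ci ct mi0.
  rewrite /lam; case: xgetP => [l _ /= hl|/(_ s)/(_ hs) //]; split=> //.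
  by apply: contra_neq t0 => l0; rewrite hl l0 scale0r.
pose b i j y : 'F_2 := sgn2 (lam i j y).
have lb i j : locally_constant (W i `&` W j) (b i j).
  move=> y [Wi Wj]; have [l dl] := dom_cover M y.
  (* in a chart, the factor of two parallel vectors has the sign of their inner
     product, which is continuous *)
  pose P z : 'rV[R]_4 := triv M l z (tr i j z).
  pose Q z : 'rV[R]_4 := triv M l z (m i z).
  have cP : vcont y P.
    have [ci di] := sW i y Wi.
    have [cp _ _] := pP i j y Wi Wj; have [cq _ _] := qP i j y Wi Wj.
    apply: vcont_near (rho_cont (oA (r i)) ci (fA (r i)) (oB (r' i)) di (fB (r' i))
      (vcont_qconj cp) cq (mc j y l Wj dl) dl dl).
    by apply: filterS (near_dom dl) => z dz; rewrite /P /tr trivK.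
  have bd : bilin (fun u v : 'rV[R]_4 => (u *m v^T) 0 0 : R^o).
    split=> [v|v] s u1 u2; first by rewrite mulmxDl -scalemxAl !mxE.
    by rewrite linearP /= mulmxDr -scalemxAr !mxE.
  have cPQ : continuous_at y (fun z => (P z *m (Q z)^T) 0 0).
    exact: (vcont_bilinR bd cP (mc i y l Wi dl)).
  have Q0 z : W i z -> dom M l z -> Q z != 0.
    move=> /mP [mz _] dz; apply: contra_neq mz => /(congr1 (frame M l z)).
    by rewrite trivK // linear0.
  have PQ z : W i z -> W j z -> dom M l z ->
      (P z *m (Q z)^T) 0 0 = lam i j z * (Q z *m (Q z)^T) 0 0.
    move=> Wiz Wjz dz; have [e _] := lamP i j z Wiz Wjz.
    by rewrite /P e linearZ /= -scalemxAl mxE.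
  have bE z : W i z -> W j z -> dom M l z -> sgn2 ((P z *m (Q z)^T) 0 0) = b i j z.
    move=> Wiz Wjz dz; have [_ l0] := lamP i j z Wiz Wjz.
    have q0 := dot4_gt0 (Q0 z Wiz dz).
    have s0 : sgn2 ((Q z *m (Q z)^T) 0 0) = 0 by rewrite /sgn2 q0.
    by rewrite PQ // sgn2M //; [rewrite s0 addr0 | rewrite gt_eqF].
  have PQ0 : (P y *m (Q y)^T) 0 0 != 0.
    have [_ l0] := lamP i j y Wi Wj.
    by rewrite PQ // mulf_neq0 // gt_eqF // dot4_gt0 // Q0.
  have nW : nbhs y (W i `&` W j) by apply: filterI; apply: open_nbhs_nbhs.
  apply: filterS3 nW (near_dom dl) (sgn2_near cPQ PQ0) => z [Wiz Wjz] dz.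
  by rewrite !bE.
exists I, W, r, r', b; split=> //.
move=> i j k y Wi Wj Wk.
have [ci di] := sW i y Wi; have [cj dj] := sW j y Wj; have [ck dk] := sW k y Wk.
have [_ np hpi] := pP i j y Wi Wj; have [_ n1 hqi] := qP i j y Wi Wj.
have [eij lij] := lamP i j y Wi Wj; have [ejk ljk] := lamP j k y Wj Wk.
have [eik lik] := lamP i k y Wi Wk; have [mi0 _] := mP i y Wi.
set e := cval c (r i) (r j) (r k) y; set f := cval d (r' i) (r' j) (r' k) y.
have key : lam j k y * lam i j y = (-1) ^+ e * ((-1) ^+ f * lam i k y).
  have := rho_change_comp PsiM (oFA i y Wi) (oFA j y Wj) (oFB i y Wi) (oFB j y Wj)
    np n1 hpi hqi (p (r j) (r k) y) (q (r' j) (r' k) y) (m k y).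
  have -> : (p (r i) (r j) y : quat R) * p (r j) (r k) y = (-1) ^+ e *: p (r i) (r k) y.
    exact: Hp.
  have -> : (q (r' i) (r' j) y : quat R) * q (r' j) (r' k) y = (-1) ^+ f *: q (r' i) (r' k) y.
    exact: Hq.
  rewrite -/(tr j k y) ejk linearZ /= -/(tr i j y) eij.
  have -> : qconj ((-1) ^+ e *: p (r i) (r k) y) = (-1) ^+ e *: qconj (p (r i) (r k) y).
    by apply: quatP; rewrite !(qconjE, qE); ring.
  rewrite rhoZl rhoZr -/(tr i k y) eik !scalerA => /eqP.
  rewrite -subr_eq0 -scalerBl scaler_eq0 (negPf mi0) orbF subr_eq0 => /eqP ->.
  by rewrite mulrA.
have s1 (z : 'F_2) : (-1) ^+ z != 0 :> R by rewrite signr_eq0.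
move/(congr1 sgn2): key; rewrite !sgn2M ?mulf_neq0 // !sgn2_sign -!/(b _ _ _) => key.
have -> : f - e = (e + (f + b i k y)) - b i k y - (e + e) by ring.
by rewrite -key char2; ring.
Qed.

End Forward.

(** * Cohomologous cocycles give a Morita equivalence *)

Section Iota.
Context {R : realType}.

Lemma iota_linear : linear (fun h : quat R => \row_(k < 4) qre (h * qconj (qb k))).
Proof.
by move=> s u v; apply/rowP => k; rewrite !mxE mulrDl -scalerAl qaddE qscaleE.
Qed.

Lemma iotaV_linear : linear (fun u : 'rV[R]_4 => \sum_k u 0 k *: qb k : quat R).
Proof.
move=> s u v; rewrite scaler_sumr -big_split; apply: eq_bigr => k _ /=.
by rewrite !mxE scalerDl scalerA.
Qed.

Definition iota : 'Hom(quat R, 'rV[R]_4) := lin_of iota_linear.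
Definition iotaV : 'Hom('rV[R]_4, quat R) := lin_of iotaV_linear.

Lemma iotaK : cancel iota iotaV.
Proof.
move=> h; rewrite !lin_ofE [RHS]quat_decomp; apply: eq_bigr => k _.
by rewrite mxE.
Qed.

Lemma iotaVK : cancel iotaV iota.
Proof.
move=> u; rewrite !lin_ofE; apply/rowP => k; rewrite mxE sum4 !qbE.
have [->|[->|[->|->]]] : k = 0 \/ k = 1 \/ k = 2 \/ k = 3.
  case: k => -[|[|[|[|//]]]] lt; [left|right;left|do 2 right;left|do 3 right];
  exact/val_inj.
all: by rewrite !qbE !(qconjE, qE); ring.
Qed.

Lemma lrmul_linear (u v : quat R) : linear (fun h : quat R => u * h * v).
Proof. by move=> s h k; rewrite mulrDr mulrDl -scalerAr -scalerAl. Qed.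

Definition lrmul (u v : quat R) : 'End(quat R) := lin_of (lrmul_linear u v).

Lemma lrmulE u v h : lrmul u v h = u * h * v.
Proof. exact: lin_ofE. Qed.

Lemma lrmul_comp u v u' v' : (lrmul u v \o lrmul u' v')%VF = lrmul (u * u') (v' * v).
Proof. by apply/lfunP => h; rewrite comp_lfunE !lrmulE !mulrA. Qed.

Lemma bilin_lrmul : bilin lrmul.
Proof.
split=> [v|u] s a b; apply/lfunP => h;
  rewrite add_lfunE scale_lfunE !lrmulE.
  by rewrite !mulrDl -!scalerAl.
by rewrite mulrDr -scalerAr.
Qed.

End Iota.

Section TensorMul.
Context {R : realType}.

Lemma tensor_mul_linearr (V W : vectType R) (mV : V -> V -> V) (mW : W -> W -> W) N :
  linear (tensor_mul mV mW N).
Proof.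
have E P : tensor_mul mV mW N P = \sum_i \sum_j N i j *:
    tlift (fun a b => tens (mV (vbasis {:V})`_i a) (mW (vbasis {:W})`_j b)) P by [].
move=> s P Q; rewrite !E scaler_sumr -big_split.
apply: eq_bigr => i _ /=; rewrite scaler_sumr -big_split; apply: eq_bigr => j _ /=.
rewrite tlift_linear scalerDr !scalerA; congr (_ *: _ + _); exact: mulrC.
Qed.

End TensorMul.

Section SignF2.
Context {R : realType}.

Lemma signF2D (e f : 'F_2) : (-1) ^+ (e + f)%R = (-1) ^+ e * (-1) ^+ f :> R.
Proof.
case: e f => -[|[|//]] le [[|[|//]] lf]; rewrite /= ?expr0 ?expr1 ?mul1r ?mulr1 //.
by rewrite mulrNN mulr1.
Qed.

Lemma sign_sqr (e : 'F_2) : ((-1) ^+ e : R) * (-1) ^+ e = 1.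
Proof. by rewrite -signF2D; case: e => -[|[|//]] lt; rewrite /= ?expr0. Qed.

End SignF2.

Section Glue.
Context {R : realType} {X : topologicalType} (A B : oe3bundle R X).
Context (I : Type) (W : I -> set X).
Context (tA : I -> forall x, 'Hom(fib A x, 'rV[R]_3)).
Context (tB : I -> forall x, 'Hom(fib B x, 'rV[R]_3)).
Context (p q : I -> I -> X -> quat R).
Hypotheses (oW : forall i, open (W i)) (cW : forall x, exists i, W i x).
Hypotheses (fA : forall i, cont_oframe (W i) (tA i)) (fB : forall i, cont_oframe (W i) (tB i)).
Hypothesis pP : forall i j x, W i x -> W j x -> [/\ vcont x (p i j), qnorm2 (p i j x) = 1 &
  spin_lift (tA i x) (tA j x) (p i j x)].
Hypothesis qP : forall i j x, W i x -> W j x -> [/\ vcont x (q i j), qnorm2 (q i j x) = 1 &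
  spin_lift (tB i x) (tB j x) (q i j x)].
Hypothesis pq : forall i j k x, W i x -> W j x -> W k x -> exists e : R,
  [/\ e * e = 1, p i j x * p j k x = e *: p i k x & q i j x * q j k x = e *: q i k x].

Let g i j x : 'End(quat R) := lrmul (p i j x) (qconj (q i j x)).

(** The signs of the two cocycles cancel, so the maps [g i j] satisfy the cocycle
  condition exactly. *)
Lemma glue_comp i j k x : W i x -> W j x -> W k x ->
  (g i j x \o g j k x)%VF = g i k x.
Proof.
move=> Wi Wj Wk; have [e [e1 pe qe]] := pq Wi Wj Wk.
rewrite /g lrmul_comp pe -qconjM qe; apply/lfunP => h; rewrite !lrmulE.
have -> : qconj (e *: q i k x) = e *: qconj (q i k x).
  by apply: quatP; rewrite !(qconjE, qE); ring.
by rewrite -scalerAl -scalerAr -scalerAl scalerA e1 scale1r.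
Qed.

Lemma glue_id i x : W i x -> g i i x =1 id.
Proof.
move=> Wi h; have [_ np _] := pP Wi Wi; have [_ n1 _] := qP Wi Wi.
have K : cancel (g i i x) (lrmul (qconj (p i i x)) (q i i x)).
  move=> u; rewrite !lrmulE !mulrA mulq_conjl np scale1r mul1r -mulrA mulq_conjl n1.
  by rewrite scale1r mulr1.
by apply: (can_inj K); rewrite -comp_lfunE glue_comp.
Qed.

Let g_cont i j x h : W i x -> W j x -> vcont x (fun y => g i j y h).
Proof.
move=> Wi Wj; have [cp _ _] := pP Wi Wj; have [cq _ _] := qP Wi Wj.
apply: (@vcont_near _ _ _ _ (fun y => p i j y * h * qconj (q i j y))).
  by apply: nearW => y; rewrite lrmulE.
apply: vcont_mulq; last exact: vcont_qconj.
by apply: vcont_mulq => //; exact: vcont_cst.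
Qed.

Let near_W i x : W i x -> \forall y \near x, W i y.
Proof. by move=> Wx; apply: open_nbhs_nbhs. Qed.

Let s_spec : {s : X -> I | forall x, W (s x) x}.
Proof. by have [s Hs] := choice cW; exists s. Qed.
Let s := sval s_spec.
Let Ws x : W (s x) x. Proof. exact: (svalP s_spec). Qed.

Let mtriv i x : 'Hom(quat R, 'rV[R]_4) := (iota \o g i (s x) x)%VF.
Let mframe i x : 'Hom('rV[R]_4, quat R) := (g (s x) i x \o iotaV)%VF.

Let mtrivK i x : W i x -> cancel (mtriv i x) (mframe i x).
Proof.
move=> Wi h; rewrite !comp_lfunE iotaK -comp_lfunE glue_comp //.
exact: glue_id.
Qed.

Let mframeK i x : W i x -> cancel (mframe i x) (mtriv i x).
Proof.
move=> Wi u; rewrite !comp_lfunE -[g i _ _ _]comp_lfunE glue_comp // glue_id //.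
exact: iotaVK.
Qed.

Let mtrans_cont i j x : W i x -> W j x ->
  hcont x (fun y => (mtriv j y \o mframe i y)%VF).
Proof.
move=> Wi Wj u.
apply: (@vcont_near _ _ _ _ (fun y => iota (g j i y (iotaV u)))).
  apply: filterS2 (near_W Wi) (near_W Wj) => y Wiy Wjy.
  by rewrite !comp_lfunE -[g j (s y) _ _]comp_lfunE glue_comp.
apply: (@vcont_lin R X (quat R) 'rV[R]_4 iota); first exact: linearP.
exact: g_cont.
Qed.

(** The quotient of the disjoint union of the [W i] times the quaternions by the
  identifications [g i j]: choosing an index [s x] at each point replaces
  equivalence classes by representatives. *)
Definition glued : vbundle X 'rV[R]_4 :=
  @VBundle R X 'rV[R]_4 (fun=> quat R : vectType R) I W mtriv mframe oW cW
    mtrivK mframeK mtrans_cont.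

Let TT := tensor_alg (quat_alg A) (opp_alg (quat_alg B)).

Let qA i x (v : R^o * fib A x) : quat R := rid_lfun (tA i x) v.
Let qB i x (v : R^o * fib B x) : quat R := rid_lfun (tB i x) v.

Let act i x (u : R^o * fib A x) (v : R^o * fib B x) : 'End(quat R) :=
  lrmul (qA i u) (qB i v).

Let bilin_act i x : bilin (@act i x).
Proof.
have [Bl Br] := @bilin_lrmul R.
by split=> [v|u] a u1 u2; rewrite /act /qA /qB linearP ?Bl ?Br.
Qed.

Let Psi x : 'Hom(fib TT x, fib (end_alg glued) x) := lin_of (tlift_linear (@act (s x) x)).

Let Psi_tens x u v : Psi x (tens u v) = act (s x) u v.
Proof. by rewrite lin_ofE tliftE //; exact: bilin_act. Qed.

Let hA x : oframe (tA (s x) x). Proof. exact: (fA (Ws x)).1. Qed.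
Let hB x : oframe (tB (s x) x). Proof. exact: (fB (Ws x)).1. Qed.

Let Psi1 x : Psi x (aone TT x) = aone (end_alg glued) x.
Proof.
rewrite Psi_tens; apply/lfunP => h; rewrite lrmulE id_lfunE /qA /qB !rid_lfunE /=.
by rewrite !linear0 mul1r mulr1.
Qed.

Let PsiM x a b : Psi x (amul TT x a b) = amul (end_alg glued) x (Psi x a) (Psi x b).
Proof.
have bA := bilin_qmul (hA x); have [Bl Br] := bilin_qmul (hB x).
move: a; apply: tensor_ext.
- by move=> r u v /=; rewrite /tensor_mul tlift_linear linearP.
- move=> r u v; apply/lfunP => h.
  by rewrite linearP /= !(add_lfunE, scale_lfunE, comp_lfunE).
move=> u v; move: b; apply: tensor_ext.
- by move=> r u1 u2 /=; rewrite tensor_mul_linearr linearP.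
- move=> r u1 u2; apply/lfunP => h.
  by rewrite linearP /= !(add_lfunE, scale_lfunE, comp_lfunE) linearP.
move=> u' v'; rewrite /= (tensor_mul_tens _ _ _ _ bA (conj Br Bl)) !Psi_tens.
by rewrite /act lrmul_comp /qA /qB !rid_mul.
Qed.

(* The sum over [p] extracts the component of [h] along [qb r], as in
   [sum_sandwich], so that the double sum rebuilds [f] from its values. *)
Let Psi_surj x f : exists N, Psi x N = f.
Proof.
pose cA (h : quat R) := qcoord (tA (s x) x) h; pose cB (h : quat R) := qcoord (tB (s x) x) h.
exists (4^-1 *: \sum_r \sum_p tens (cA (f (qb r) * qb p)) (cB (qconj (qb r) * qconj (qb p)))).
apply/lfunP => h; rewrite linearZ /= linear_sum scale_lfunE sum_lfunE.
transitivity (4^-1 *: \sum_r f (qb r) * ((4 * qre (h * qconj (qb r))) *: 1)).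
  congr (_ *: _); apply: eq_bigr => r _; rewrite linear_sum sum_lfunE.
  rewrite -sum_sandwich mulr_sumr; apply: eq_bigr => k _.
  by rewrite /= Psi_tens lrmulE /qA /qB !qcoordK // !mulrA.
rewrite scaler_sumr {2}(quat_decomp h) linear_sum; apply: eq_bigr => r _.
by rewrite -scalerAr mulr1 scalerA mulrA mulVf ?mul1r ?pnatr_eq0 // linearZ.
Qed.

Let Psi_bij x : bijective (Psi x).
Proof.
have full : limg (Psi x) = fullv.
  apply/eqP; rewrite eqEsubv subvf; apply/subvP => f _.
  by have [N <-] := Psi_surj f; exact: memv_img (memvf _).
have dA : \dim {:(R^o * fib A x)%type} = 4.
  by have := oframe_dim (hA x); rewrite !dimvf => d3; rewrite -[LHS]/(1 + dim (fib A x))%N d3.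
have dB : \dim {:(R^o * fib B x)%type} = 4.
  by have := oframe_dim (hB x); rewrite !dimvf => d3; rewrite -[LHS]/(1 + dim (fib B x))%N d3.
have dT : \dim {:fib TT x} = 16.
  by rewrite dimvf /dim /= dA dB.
have dE : \dim {:'End(quat R)} = 16 by rewrite dimvf.
have k0 : lker (Psi x) == 0%VS.
  have := limg_ker_dim (Psi x) fullv; rewrite full dE dT capfv.
  by rewrite -dimv_eq0 => /eqP; rewrite -[X in _ == X]add0n eqn_add2r.
exists (Psi x)^-1%VF; first exact: lker0_lfunK.
by move=> f; have [N <-] := Psi_surj f; rewrite lker0_lfunK.
Qed.


(* In the chart [j] the action at [y] does not depend on the index [s y]. *)
Let actE i j x (u : R^o * fib A x) (v : R^o * fib B x) : W i x -> W j x ->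
  (g j i x \o (act i u v \o g i j x))%VF = act j u v.
Proof.
move=> Wi Wj; have [_ _ hp] := pP Wi Wj; have [_ n1 hq] := qP Wi Wj.
have -> : (act i u v \o g i j x)%VF = (g i j x \o act j u v)%VF.
  rewrite /act /g !lrmul_comp; congr lrmul; first exact: spin_lift_rid.
  by apply: qconj_intertwine => //; exact: spin_lift_rid.
rewrite comp_lfunA glue_comp //; apply/lfunP => h.
by rewrite comp_lfunE glue_id.
Qed.

Let qA_cont a j x e : dom A a x -> W j x ->
  vcont x (fun y => qA j (rid_lfun (frame A a y) e)).
Proof.
move=> da Wj; apply: (@vcont_near _ _ _ _
  (fun y => (e.1, (tA j y \o frame A a y)%VF e.2) : quat R)).
  by apply: nearW => y; rewrite /qA !rid_lfunE /= comp_lfunE.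
by apply: vcont_quat; exact: (fA Wj).2.
Qed.

Let qB_cont b j x e : dom B b x -> W j x ->
  vcont x (fun y => qB j (rid_lfun (frame B b y) e)).
Proof.
move=> db Wj; apply: (@vcont_near _ _ _ _
  (fun y => (e.1, (tB j y \o frame B b y)%VF e.2) : quat R)).
  by apply: nearW => y; rewrite /qB !rid_lfunE /= comp_lfunE.
by apply: vcont_quat; exact: (fB Wj).2.
Qed.

Lemma alg_iso_glued : alg_iso TT (end_alg glued).
Proof.
exists Psi; split=> //.
move=> [a b] j x [da db] Wj N.
pose F y : 'Hom((R^o * 'rV[R]_3)%type, (R^o * fib A y)%type) := rid_lfun (frame A a y).
pose G y : 'Hom((R^o * 'rV[R]_3)%type, (R^o * fib B y)%type) := rid_lfun (frame B b y).
pose ee k : quat R := (vbasis {:(R^o * 'rV[R]_3)%type})`_k.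
apply: (@vcont_near _ _ _ _ (fun y => \sum_k \sum_l N k l *:
    lconj iota iotaV (act j (F y (ee k)) (G y (ee l))))).
  apply: filterS (near_W Wj) => y Wjy.
  rewrite !comp_lfunE [X in Psi y X]tmapE /tlift linear_sum linear_sum.
  apply: eq_bigr => k _; rewrite linear_sum linear_sum; apply: eq_bigr => l _.
  rewrite !linearZ; congr (_ *: _); rewrite /= Psi_tens !lconjE.
  rewrite -(actE _ _ (Ws y) Wjy) /mtriv /mframe.
  by apply/lfunP => h; rewrite !comp_lfunE.
have llc : linear (lconj (@iota R) (@iotaV R)) by exact: linearP.
apply: vcont_sum => k; apply: vcont_sum => l; apply: vcontZ; first exact: cvg_cst.
apply: (vcont_lin llc); apply: (vcont_bilin (@bilin_lrmul R)).
  exact: qA_cont.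
exact: qB_cont.
Qed.

Lemma glue_morita : morita A B.
Proof. by exists glued; exact: alg_iso_glued. Qed.

End Glue.

(** The cochain [b] corrects the lifts for [B], after which both families have the
  same defect [(-1) ^+ e] and can be glued. *)
Lemma cohomologous_morita (R : realType) (X : topologicalType)
    (A B : oe3bundle R X) (c d : cech2 X) :
  spin_cocycle A c -> spin_cocycle B d -> cohomologous c d -> morita A B.
Proof.
move=> [tA [p [hA1 hA2 hp Hp]]] [tB [q [hB1 hB2 hq Hq]]].
move=> [I [W [r [r' [b [oW cW sW lb hb]]]]]].
have fA := spin_cont_oframe hA1 hA2; have fB := spin_cont_oframe hB1 hB2.
pose pa i j y := p (r i) (r j) y.
pose qb i j y : quat R := (-1) ^+ (b i j y) *: q (r' i) (r' j) y.
have fA' i : @cont_oframe R X A (W i) (tA (r i)) by move=> y /sW [? _]; exact: fA.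
have fB' i : @cont_oframe R X B (W i) (tB (r' i)) by move=> y /sW [_ ?]; exact: fB.
apply: (@glue_morita R X A B I W (fun i => tA (r i)) (fun i => tB (r' i)) pa qb) => //.
- by move=> i j x /sW [ci _] /sW [cj _]; exact: hp.
- move=> i j x Wi Wj; have [_ di] := sW _ _ Wi; have [_ dj] := sW _ _ Wj.
  have [cq n1 hqi] := hq _ _ _ di dj; split.
  + apply: vcontZ cq; apply/vcontR.
    apply: (@vcont_near R X R^o x (fun=> (-1) ^+ (b i j x))); last exact: vcont_cst.
    by apply: filterS (lb i j x (conj Wi Wj)) => y ->.
  + by rewrite qnorm2Z expr2 sign_sqr mul1r.
  + by move=> v; rewrite /qb -scalerAr -scalerAl; congr (_ *: _); exact: hqi.
move=> i j k x Wi Wj Wk.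
have [ci di] := sW _ _ Wi; have [cj dj] := sW _ _ Wj; have [ck dk] := sW _ _ Wk.
set e := cval c (r i) (r j) (r k) x; set f := cval d (r' i) (r' j) (r' k) x.
exists ((-1) ^+ e); split; first exact: sign_sqr.
  exact: Hp.
rewrite /qb -scalerAl -scalerAr.
have -> : (q (r' i) (r' j) x : quat R) * q (r' j) (r' k) x = (-1) ^+ f *: q (r' i) (r' k) x.
  exact: Hq.
rewrite !scalerA; congr (_ *: _); rewrite -!signF2D; congr (_ ^+ nat_of_ord _).
have h : f - e = b j k x - b i k x + b i j x by exact: hb.
have -> : f = e + (f - e) by ring.
rewrite h -[RHS]addr0 -(char2 (b i k x)).
transitivity (e + b i k x + ((b i j x + b i j x) + (b j k x + b j k x) -
  (b i k x + b i k x))); first by ring.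
by rewrite !char2; ring.
Qed.

(** * Morita equivalence and w_2 *)

Theorem theorem2p7 (R : realType) (X : topologicalType)
  (hX : hausdorff_space X) (cX : compact [set: X]%classic)
  (alpha beta : oe3bundle R X) :
  morita alpha beta <-> w2 alpha = w2 beta.
Proof.
have [c sc] := spin_cocycle_exists alpha hX cX.
have [d sd] := spin_cocycle_exists beta hX cX.
split=> [[M [Psi [cPsi bPsi Psi1 PsiM]]]|w2E].
  have coh c' d' : spin_cocycle alpha c' -> spin_cocycle beta d' -> cohomologous c' d'.
    exact: (morita_cohomologous cPsi bPsi Psi1 PsiM cX).
  apply/seteqP; split=> z [z0 sz hz].
    exists d => //; apply: cohomologous_trans hz.
    by apply: cohomologous_sym; exact: coh.
  by exists c => //; apply: cohomologous_trans hz; exact: coh.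
have [d' sd' hd'] : w2 beta c.
  by rewrite -w2E; exists c => //; exact: cohomologous_refl.
by apply: (cohomologous_morita sc sd'); exact: cohomologous_sym.
Qed.
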